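(* Let $u_0,u_1\in\mathbb{C}$ and $\rho\in\mathbb{C}$. The unique solution $u_{\mathfrak{I}_N}(\rho,\cdot)\in\mathcal{D}_2(\mathbf{L}_{q,\mathfrak{I}_N})$ of the Cauchy problem $$\mathbf{L}_{q,\mathfrak{I}_N}u=\rho^2u\ \text{ on }(0,b),\qquad u(0)=u_0,\quad u'(0)=u_1,$$ has the form $$u_{\mathfrak{I}_N}(\rho,x)=\widetilde u(\rho,x)+\sum_{k=1}^{N}\alpha_k\widetilde u(\rho,x_k)H(x-x_k)\widehat s_k(\rho,x-x_k)+\sum_{J\in\mathcal{J}_N}\alpha_JH(x-x_{j_{|J|}})\widetilde u(\rho,x_{j_1})\left(\prod_{l=1}^{|J|-1}\widehat s_{j_l}(\rho,x_{j_{l+1}}-x_{j_l})\right)\widehat s_{j_{|J|}}(\rho,x-x_{j_{|J|}}),$$ where $\widetilde u(\rho,x)$ is the unique solution of the regular Schr\''odinger equation $-\widetilde u''+q(x)\widetilde u=\rho^2\widetilde u$ on $(0,b)$ satisfying $\widetilde u(\rho,0)=u_0$, $\widetilde u'(\rho,0)=u_1$.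
   Context: Let $b>0$, let $q\in L_2(0,b)$ be complex valued, $N\in\mathbb{N}$, $0<x_1<\dots<x_N<b$, $\alpha_1,\dots,\alpha_N\in\mathbb{C}\setminus\{0\}$, $x_0=0$, $x_{N+1}=b$, $\mathfrak{I}_N=\{(x_j,\alpha_j)\}_{j=1}^N$. The regularization domain $\mathcal{D}_2(\mathbf{L}_{q,\mathfrak{I}_N})$ is the set of $u\in AC[0,b]$ such that $u|_{(x_k,x_{k+1})}\in H^2(x_k,x_{k+1})$ for $k=0,\dots,N$ and $u'(x_k+)-u'(x_k-)=\alpha_ku(x_k)$ for $k=1,\dots,N$. A solution of $\mathbf{L}_{q,\mathfrak{I}_N}u=\lambda u$ (formally $-u''+(q(x)+\sum_{k=1}^N\alpha_k\delta(x-x_k))u=\lambda u$ on $(0,b)$) is a function $u\in\mathcal{D}_2(\mathbf{L}_{q,\mathfrak{I}_N})$ satisfying $-u''+qu=\lambda u$ a.e. on each $(x_k,x_{k+1})$. For $k\in\{1,\dots,N\}$, $\widehat s_k(\rho,x)$ is the unique solution of $-\widehat s_k''(\rho,x)+q(x+x_k)\widehat s_k(\rho,x)=\rho^2\widehat s_k(\rho,x)$ for $0<x<b-x_k$ with $\widehat s_k(\rho,0)=0$, $\widehat s_k'(\rho,0)=1$. $H=\chi_{(0,\infty)}$ is the Heaviside function; a product containing a factor $H(x-x_k)$ is read as $0$ for $x\le x_k$. $\mathcal{J}_N$ is the set of finite sequences $J=(j_1,\dots,j_l)$ with $1<l\le N$, $\{j_1,\dots,j_l\}\subset\{1,\dots,N\}$,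 $j_1<\dots<j_l$; $|J|=l$ is the length of $J$ and $\alpha_J=\alpha_{j_1}\cdots\alpha_{j_{|J|}}$. *)

(* Defs.v *)
From mathcomp Require Import all_boot all_order all_algebra.
From mathcomp Require Import all_classical all_reals all_analysis.
From mathcomp Require Import complex.

Set Implicit Arguments.
Unset Strict Implicit.
Unset Printing Implicit Defensive.

Import Order.TTheory GRing.Theory Num.Theory.
Import numFieldNormedType.Exports.

Local Open Scope classical_set_scope.
Local Open Scope ring_scope.

Section RealSpaces.
Context {R : realType}.
Local Notation mu := (@lebesgue_measure R).
Implicit Types (a b : R) (f g phi : R -> R).

Definition L2_real a b f : Prop := f \_ `]a, b[ \in Lfun mu 2%:E.

Definition AC_real a b f : Prop :=
  forall e : R, 0 < e -> exists2 d : R, 0 < d &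
    forall (n : nat) (s t : 'I_n -> R),
      (forall i, [/\ a <= s i, s i <= t i & t i <= b]) ->
      trivIset [set: 'I_n] (fun i => `]s i, t i[%classic) ->
      \sum_(i < n) (t i - s i) < d ->
      \sum_(i < n) `|f (t i) - f (s i)| < e.

Definition C1c a b phi : Prop :=
  [/\ forall x, derivable phi x 1,
      continuous (derive1 phi) &
      exists c d, [/\ a < c, d < b & forall x, x \notin `[c, d] -> phi x = 0]].

(* Sobolev's definition on an interval, with C^1_c test functions (Brezis,
   Functional Analysis, Sobolev Spaces and PDE, section 8.2). *)
Definition weak_derivative_real a b f g : Prop :=
  [/\ L2_real a b f, L2_real a b g &
      forall phi, C1c a b phi ->
        \int[mu]_(x in `]a, b[) (f x * derive1 phi x) =
        - \int[mu]_(x in `]a, b[) (g x * phi x)].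

End RealSpaces.

Section Schrodinger.
Context {R : realType}.
Local Notation C := R[i].
Local Notation mu := (@lebesgue_measure R).
Implicit Types (a b c : R) (q u v w : R -> C) (lambda : C).

(* The spaces of complex-valued functions are taken componentwise. *)
Definition re u : R -> R := fun t => complex.Re (u t).
Definition im u : R -> R := fun t => complex.Im (u t).

Definition L2 a b u : Prop := L2_real a b (re u) /\ L2_real a b (im u).

Definition AC a b u : Prop := AC_real a b (re u) /\ AC_real a b (im u).

(* u and v are square integrable and v = u' weakly on (a, b). *)
Definition weak_derivative a b u v : Prop :=
  weak_derivative_real a b (re u) (re v) /\
  weak_derivative_real a b (im u) (im v).

Definition H2 a b u : Prop :=
  exists v w, weak_derivative a b u v /\ weak_derivative a b v w.

(* - u'' + q u = lambda u a.e. on (a, b), where u'' is the second weak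
   derivative, which is unique up to a null set. *)
Definition schrodinger_ae a b q lambda u : Prop :=
  exists v w, [/\ weak_derivative a b u v, weak_derivative a b v w &
    {ae mu, forall t, t \in `]a, b[ -> - w t + q t * u t = lambda * u t}].

(* u'(c+) = l and u'(c-) = l.  A continuous function in H2 a b is C^1 on
   ]a, b[ with a derivative extending continuously to [a, b], so there the
   derivative below is the classical one and these limits exist. *)
Definition derivative_right u c (l : C) : Prop :=
  derive1 (re u) t @[t --> c^'+] --> complex.Re l /\ derive1 (im u) t @[t --> c^'+] --> complex.Im l.

Definition derivative_left u c (l : C) : Prop :=
  derive1 (re u) t @[t --> c^'-] --> complex.Re l /\ derive1 (im u) t @[t --> c^'-] --> complex.Im l.

(* The regular problem on (0, c); AC selects the continuous representative
   of an H2 class. *)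
Definition regular_cauchy c q lambda (u0 u1 : C) u : Prop :=
  [/\ AC 0 c u, H2 0 c u, schrodinger_ae 0 c q lambda u,
      u 0 = u0 & derivative_right u 0 u1].

(* The nodes are x 0 = 0 < x 1 < ... < x N < x N.+1 = b; only the values
   alpha 1, ..., alpha N are used. *)
Definition D2 b N (x : nat -> R) (alpha : nat -> C) u : Prop :=
  [/\ AC 0 b u,
      forall k, (k <= N)%N -> H2 (x k) (x k.+1) u &
      forall k, (1 <= k <= N)%N -> exists l r : C,
        [/\ derivative_left u (x k) l, derivative_right u (x k) r &
            r - l = alpha k * u (x k)]].

Definition interaction_solution b q N (x : nat -> R) (alpha : nat -> C)
    lambda u : Prop :=
  D2 b N x alpha u /\
  forall k, (k <= N)%N -> schrodinger_ae (x k) (x k.+1) q lambda u.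

Definition interaction_cauchy b q N (x : nat -> R) (alpha : nat -> C) lambda
    (u0 u1 : C) u : Prop :=
  [/\ interaction_solution b q N x alpha lambda u,
      u 0 = u0 & derivative_right u 0 u1].

Definition unique_solution c (P : (R -> C) -> Prop) u : Prop :=
  P u /\ forall v, P v -> {in `[0, c], v =1 u}.

Definition heaviside (t : R) : C := if 0 < t then 1 else 0.

(* J = (j_1, ..., j_l) with 1 <= j_1 < ... < j_l <= N. *)
Definition increasing_indices N l (J : l.-tuple 'I_N.+1) : bool :=
  all (fun j : 'I_N.+1 => 0 < j)%N J && sorted ltn [seq val j | j <- J].

(* j_(i+1) is nth 0%N J i. *)
Definition chain_term (x : nat -> R) (alpha : nat -> C) (ut : R -> C)
    (s : nat -> R -> C) (J : seq nat) (t : R) : C :=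
  (\prod_(j <- J) alpha j) * heaviside (t - x (last 0%N J)) *
  ut (x (head 0%N J)) *
  (\prod_(0 <= i < (size J).-1)
     s (nth 0%N J i) (x (nth 0%N J i.+1) - x (nth 0%N J i))) *
  s (last 0%N J) (t - x (last 0%N J)).

Definition interaction_formula N (x : nat -> R) (alpha : nat -> C)
    (ut : R -> C) (s : nat -> R -> C) (t : R) : C :=
  ut t
  + \sum_(1 <= k < N.+1)
      alpha k * ut (x k) * heaviside (t - x k) * s k (t - x k)
  + \sum_(2 <= l < N.+1)
      \sum_(J : l.-tuple 'I_N.+1 | increasing_indices J)
        chain_term x alpha ut s [seq val j | j <- J] t.

End Schrodinger.

(* Main.v *)
Require Import Defs.
From mathcomp Require Import all_boot all_order all_algebra.
From mathcomp Require Import all_classical all_reals all_analysis.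
From mathcomp Require Import complex.
From mathcomp Require Import measurable_realfun ring lra.
Import Order.TTheory GRing.Theory Num.Theory.
Import numFieldNormedType.Exports.
Local Open Scope ring_scope.

(** Write p = q - lambda. On a segment that starts at a, the equation
          u'' = p u,
    together with the value A and the right slope S at a, is equivalent to the
    Volterra equation
          u(t) = A + S (t - a) + int_a^t (t - s) p(s) u(s) ds.

    From weak to integral form, the du Bois-Reymond lemma says that a function
    with zero weak derivative is constant almost everywhere, so that a weak
    derivative can be integrated back ([weak_derivative_is_prim]). Two such
    integrations and Cauchy's formula for repeated integrals give the Volterra
    equation almost everywhere, and continuity of u gives it everywhere
    ([weak_taylor], [schrodinger_volterra]). Conversely, the primitive of a
    square integrable function has this function as weak derivative
    ([weak_derivative_prim]); since the primitive is only absolutely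
    continuous, the integration by parts is done with Fubini's theorem on a
    triangle ([Fubini_triangle]).

    The Volterra equation is solved by Picard iteration. In the sup norm
    weighted by e^(K (t - a)) the kernel t - s costs a factor 1 / K, so for K
    large with respect to the integral of |p| the operator is a contraction on
    the whole segment ([volterra_halves]). This gives uniqueness
    ([volterra_unique]) and existence ([volterra_exists]).

    A jump beta k of the slope at x k adds the kink beta k (t - x k)^+ to the
    forcing term u0 + u1 t. Conversely, a solution of the Volterra equation
    with such kinks solves the interaction problem as soon as beta k is alpha
    k times u(x k) ([interaction_of_volterra]). Uniqueness propagates from
    node to node, since a solution on one piece is determined by its value and
    slope at the left end ([interaction_unique]); the regular problem is the
    case without interior nodes.

    It remains to identify the formula. Delayed by x k and extended by zero,
    the fundamental solution s k solves the Volterra equation with forcing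
    term (t - x k)^+ ([delayed_volterra]). By superposition, ut plus the sum
    of the beta k times these delayed solutions has the kinks beta k, and the
    conditions on the beta k become the triangular system
          beta k = alpha k (ut(x k) + sum_(i < k) beta i s_i(x k - x i)).
    Unfolding this recursion writes beta k as a sum over all increasing chains
    of nodes that end at k ([chain_totalE], [sum_chains]), and grouping the
    terms of the formula by the last index of J produces exactly these sums
    ([interaction_formulaE]). *)

Set Implicit Arguments.
Unset Strict Implicit.
Unset Printing Implicit Defensive.

(** * Square integrable functions on an interval *)

Section Integrability.
Context {R : realType}.
Local Open Scope classical_set_scope.
Local Open Scope ring_scope.
Local Notation mu := (@lebesgue_measure R).
Local Notation integ D f := (mu.-integrable D (EFin \o f)).
Implicit Types (a b c t : R) (f g w : R -> R).

Lemma integ_le (D : set (measurableTypeR R)) f g : measurable D -> measurable_fun D f ->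
  (forall t, D t -> `|f t| <= g t) -> integ D g -> integ D f.
Proof.
move=> mD mf fg ig; apply: (@le_integrable _ _ _ mu D mD _ (EFin \o g)) => //.
  exact/measurable_EFinP.
move=> t Dt /=; rewrite lee_fin.
by apply: (le_trans (fg t Dt)); exact: ler_norm.
Qed.

Lemma integ_meas (D : set (measurableTypeR R)) f : integ D f -> measurable_fun D f.
Proof. by move=> /(measurable_int mu)/measurable_EFinP. Qed.

Lemma integ_cst a b k : integ `[a, b] (fun=> k : R).
Proof.
apply: continuous_compact_integrable; first exact: segment_compact.
by apply: continuous_subspaceT => x; exact: cvg_cst.
Qed.

Lemma integD (D : set (measurableTypeR R)) f g : measurable D -> integ D f -> integ D g ->
  integ D (fun t => f t + g t).
Proof. by move=> mD i1 i2; exact: (integrableD mD i1 i2). Qed.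

Lemma integZ (D : set (measurableTypeR R)) k f : measurable D -> integ D f ->
  integ D (fun t => k * f t).
Proof. by move=> mD i1; exact: (integrableZl mD k i1). Qed.

Lemma integB (D : set (measurableTypeR R)) f g : measurable D -> integ D f -> integ D g ->
  integ D (fun t => f t - g t).
Proof. by move=> mD i1 i2; exact: (integrableB mD i1 i2). Qed.

Lemma integ_mul_bounded (D : set (measurableTypeR R)) f g M : measurable D ->
  integ D f -> measurable_fun D g ->
  (forall t, D t -> `|g t| <= M) -> integ D (fun t => f t * g t).
Proof.
move=> mD fi mg gM.
apply: (@integ_le _ _ (fun t => M * `|f t|)) => //.
- by apply: measurable_funM => //; exact: integ_meas.
- by move=> t Dt; rewrite normrM mulrC ler_wpM2r// gM.
- by apply: integZ => //; exact: integrable_norm.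
Qed.

Lemma integ_subitv a b c d f : a <= c -> d <= b -> integ `[a, b] f ->
  integ `[c, d] f.
Proof.
move=> ac db; apply: integrableS => //.
by apply: subset_itv; rewrite bnd_simp.
Qed.

Lemma integ_oo_cc a b f : integ `]a, b[ f <-> integ `[a, b] f.
Proof.
split; last by apply: integrableS => //; exact: subset_itv_oo_cc.
move=> /integrableP[mf fi]; apply/integrableP.
have mf' : measurable_fun `[a, b] (EFin \o f) by exact: emeasurable_fun_itv_cc mf.
split => //.
have mn : measurable_fun `]a, b[ (fun x => `|(EFin \o f) x|%E).
  exact: measurableT_comp.
have E := @integral_itv_bndoo R a b _ true false mn.
by rewrite [ltLHS]E.
Qed.

Lemma integ_restrict (D : set (measurableTypeR R)) f : measurable D ->
  integ D f <-> mu.-integrable setT (EFin \o (f \_ D)).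
Proof.
by move=> mD; rewrite -restrict_EFin; apply: integrable_mkcond.
Qed.

Lemma L2_realP a b f : L2_real a b f <->
  measurable_fun `]a, b[ f /\ integ `]a, b[ (fun t => f t ^+ 2).
Proof.
have E : (fun t => f t ^+ 2) \_ `]a, b[ = (fun t => (f \_ `]a, b[) t ^+ 2).
  by apply/funext => t /=; rewrite /patch; case: ifP => // _; rewrite expr0n.
split.
- move=> h; split.
    move: h; rewrite /L2_real inE => /andP[mf _]; move: mf; rewrite inE/= => mf.
    by apply/(measurable_restrictT _ _).2.
  apply/integ_restrict => //; rewrite E; exact: Lfun2_integrable_sqr.
- move=> [mf fi]; rewrite /L2_real inE; apply/andP; split; rewrite inE/=.
    by apply/(measurable_restrictT _ _).1.
  rewrite /finite_norm unlock /Lnorm poweR_lty//.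
  have -> : (\int[mu]_x `|(EFin \o f \_ `]a, b[) x| `^ 2 =
      \int[mu]_x ((f \_ `]a, b[) x ^+ 2)%:E)%E.
    apply: eq_integral => t _ /=; congr EFin.
    by rewrite powR_mulrn// real_normK ?num_real.
  apply: integrable_lty => //.
  by move/(integ_restrict _ _).1 : fi; rewrite E; exact.
Qed.

Lemma integ_mul_L2 a b f g : L2_real a b f -> L2_real a b g ->
  integ `]a, b[ (fun t => f t * g t).
Proof.
move=> /L2_realP[mf fi] /L2_realP[mg gi].
apply: (@integ_le _ _ (fun t => f t ^+ 2 + g t ^+ 2)) => //.
- exact: measurable_funM.
- move=> t _; rewrite normrM -(real_normK (num_real (f t))).
  rewrite -(real_normK (num_real (g t))).
  have := normr_ge0 (f t); have := normr_ge0 (g t); nra.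
- exact: integD.
Qed.

Lemma L2_cst a b k : L2_real a b (fun=> k).
Proof.
apply/L2_realP; split; first exact: measurable_cst.
by apply/integ_oo_cc; exact: integ_cst.
Qed.

Lemma L2_integ_oo a b f : L2_real a b f -> integ `]a, b[ f.
Proof.
move=> h; have := integ_mul_L2 h (L2_cst a b 1).
by apply: eq_integrable => // t _ /=; rewrite mulr1.
Qed.

Lemma L2_integ a b f : L2_real a b f -> integ `[a, b] f.
Proof. by move=> /L2_integ_oo/integ_oo_cc. Qed.

Lemma L2_add a b f g : L2_real a b f -> L2_real a b g ->
  L2_real a b (fun t => f t + g t).
Proof.
move=> h1 h2; have fg := integ_mul_L2 h1 h2.
have [mf fi] := (L2_realP a b f).1 h1; have [mg gi] := (L2_realP a b g).1 h2.
apply/L2_realP; split; first exact: measurable_funD.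
have -> : (fun t => (f t + g t) ^+ 2) =
    (fun t => (f t ^+ 2 + g t ^+ 2) + 2 * (f t * g t)).
  by apply/funext => t; ring.
by apply: integD => //; [exact: integD|exact: integZ].
Qed.

Lemma L2_mul_bounded a b f g M : L2_real a b f -> measurable_fun `]a, b[ g ->
  (forall t, t \in `]a, b[ -> `|g t| <= M) -> L2_real a b (fun t => f t * g t).
Proof.
move=> /L2_realP[mf fi] mg gM; apply/L2_realP; split; first exact: measurable_funM.
have -> : (fun t => (f t * g t) ^+ 2) = (fun t => f t ^+ 2 * g t ^+ 2).
  by apply/funext => t; rewrite exprMn.
apply: (@integ_mul_bounded _ _ _ (M ^+ 2)) => //.
  exact: measurable_funX.
move=> t ht; rewrite normrX lerXn2r ?nnegrE// ?gM//.
by rewrite (le_trans _ (gM t ht)).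
Qed.

Lemma L2_bounded a b g M : measurable_fun `]a, b[ g ->
  (forall t, t \in `]a, b[ -> `|g t| <= M) -> L2_real a b g.
Proof.
move=> mg gM; have := L2_mul_bounded (L2_cst a b 1) mg gM.
by rewrite (_ : (fun t => 1 * g t) = g)//; apply/funext => t; rewrite mul1r.
Qed.

Lemma L2_scale a b f k : L2_real a b f -> L2_real a b (fun t => k * f t).
Proof.
move=> h; rewrite (_ : (fun t => k * f t) = (fun t => f t * k)); last first.
  by apply/funext => t; rewrite mulrC.
exact: (L2_mul_bounded h (measurable_cst _) (fun _ _ => lexx `|k|)).
Qed.

Lemma L2_subitv a b c d f : a <= c -> d <= b -> L2_real a b f ->
  L2_real c d f.
Proof.
move=> ac db /L2_realP[mf fi]; apply/L2_realP.
have cdab : `]c, d[ `<=` `]a, b[ by apply: subset_itv; rewrite bnd_simp.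
by split; [exact: measurable_funS mf|exact: integrableS fi].
Qed.

Lemma cont_meas a b f : {within `[a, b], continuous f} -> measurable_fun `[a, b] f.
Proof. by move=> cf; exact: subspace_continuous_measurable_fun. Qed.

Lemma cont_integ a b f : {within `[a, b], continuous f} -> integ `[a, b] f.
Proof. by move=> cf; apply: continuous_compact_integrable => //; exact: segment_compact. Qed.

Lemma cont_bounded a b f : {within `[a, b], continuous f} ->
  exists2 M, 0 <= M & forall t, t \in `[a, b] -> `|f t| <= M.
Proof.
move=> cf; have [ab|ba] := leP a b; last first.
  by exists 0 => // t; rewrite in_itv/= => /andP[h1 h2]; lra.
have cn : {within `[a, b], continuous (fun t => `|f t|)}.
  by move=> t; apply: continuous_comp; [exact: cf|exact: norm_continuous].
have [c cab cmax] := EVT_max ab cn.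
by exists `|f c|.
Qed.

Lemma cont_L2 a b f : {within `[a, b], continuous f} -> L2_real a b f.
Proof.
move=> cf; have [M M0 fM] := cont_bounded cf.
apply: (@L2_bounded _ _ _ M).
  by apply: measurable_funS (cont_meas cf) => //; exact: subset_itv_oo_cc.
by move=> t tab; apply: fM; exact: subset_itv_oo_cc.
Qed.

End Integrability.

(** * Primitives and Fubini's theorem on a triangle *)

Section Primitives.
Context {R : realType}.
Local Open Scope classical_set_scope.
Local Open Scope ring_scope.
Local Notation mu := (@lebesgue_measure R).
Local Notation integ D f := (mu.-integrable D (EFin \o f)).
Implicit Types (a b c t : R) (f g w : R -> R).

Lemma Rintegral_itv_split a s t f : a <= s -> s <= t -> integ `[a, t] f ->
  \int[mu]_(r in `[a, t]) f r =
  \int[mu]_(r in `[a, s]) f r + \int[mu]_(r in `[s, t]) f r.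
Proof.
move=> as_ st fi.
rewrite -(@Rintegral_itv_obnd_cbnd _ s (BRight t)); last first.
  by apply: integrableS fi => //; apply: subset_itv; rewrite bnd_simp.
rewrite -(@Rintegral_itvB _ _ (BLeft a)) ?bnd_simp//.
by rewrite addrC subrK.
Qed.

Lemma prim_continuous a b f : integ `[a, b] f ->
  {within `[a, b], continuous (fun t => \int[mu]_(r in `[a, t]) f r)}.
Proof.
move=> fi; have [ab|ba] := leP a b; first exact: parameterized_integral_continuous.
by rewrite set_itv_ge ?bnd_simp -?ltNge//; exact: continuous_subspace0.
Qed.

Lemma Rintegral_itv1 a f : \int[mu]_(r in `[a, a]) f r = 0.
Proof. by rewrite set_itv1 Rintegral_set1. Qed.

Lemma Rintegral_itv_cst a t (k : R) : a <= t -> \int[mu]_(r in `[a, t]) k = k * (t - a).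
Proof.
move=> at_; rewrite Rintegral_cst//= lebesgue_measure_itv/= lte_fin.
by move: at_; rewrite le_eqVlt => /predU1P[->|->]; rewrite ?ltxx ?subrr.
Qed.

Lemma norm_Rintegral_le (D : set (measurableTypeR R)) f g :
  measurable D -> integ D f -> integ D g -> (forall t, D t -> `|f t| <= g t) ->
  `|\int[mu]_(t in D) f t| <= \int[mu]_(t in D) g t.
Proof.
move=> mD fi gi fg; apply: (le_trans (le_normr_Rintegral mD fi)).
by apply: le_Rintegral => //; exact: integrable_norm.
Qed.

Lemma prim_lipschitz a b f M s t : (forall r, r \in `[a, b] -> `|f r| <= M) ->
  integ `[a, b] f -> a <= s -> s <= t -> t <= b ->
  `|\int[mu]_(r in `[a, t]) f r - \int[mu]_(r in `[a, s]) f r| <= M * (t - s).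
Proof.
move=> fM fi as_ st tb; rewrite (@Rintegral_itv_split a s t)//; last exact: integ_subitv fi.
rewrite addrC addKr -Rintegral_itv_cst//.
apply: norm_Rintegral_le => //; [exact: integ_subitv fi|exact: integ_cst|].
move=> r /=; rewrite in_itv/= => /andP[h1 h2]; apply: fM; rewrite in_itv/=.
by rewrite (le_trans as_ h1) (le_trans h2 tb).
Qed.

(** Both sides integrate f t * w s over the triangle a <= s <= t <= c. With f
    the derivative of a C^1 function this is an integration by parts against
    the primitive of w, which is only absolutely continuous; with f = 1 it
    is Cauchy's formula for repeated integrals. *)
Lemma Fubini_triangle a c w f : integ `[a, c] w -> integ `[a, c] f ->
  \int[mu]_(t in `[a, c]) (f t * \int[mu]_(s in `[a, t]) w s) =
  \int[mu]_(s in `[a, c]) (w s * \int[mu]_(t in `[s, c]) f t).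
Proof.
move=> wi fi.
pose w' : R -> R := w \_ `[a, c]; pose f' : R -> R := f \_ `[a, c].
have wi' : integ setT w' by apply: (integ_restrict w _).1 => //.
have fi' : integ setT f' by apply: (integ_restrict f _).1 => //.
pose F (z : measurableTypeR R * measurableTypeR R) : R :=
  f' z.1 * w' z.2 * (if z.2 <= z.1 then 1 else 0).
have mF0 : measurable_fun setT F.
  apply: measurable_funM; first apply: measurable_funM.
  - apply: (measurableT_comp (integ_meas fi')); exact: measurable_fst.
  - apply: (measurableT_comp (integ_meas wi')); exact: measurable_snd.
  - apply: measurable_fun_ifT => //.
    by apply: measurable_fun_ler; [exact: measurable_snd|exact: measurable_fst].
have mF : measurable_fun setT (EFin \o F) by exact/measurable_EFinP.
have Fi : (mu \x mu)%E.-integrable setT (EFin \o F).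
  apply/integrable12ltyP => //.
  apply: (@le_lt_trans _ _ (\int[mu]_t (`|f' t|%:E * \int[mu]_s `|w' s|%:E))%E).
    apply: ge0_le_integral => //=.
    + by move=> t _; exact: integral_ge0.
    + apply: (measurable_fun_fubini_tonelli_F (fun z => `|(EFin \o F) z|%E)) => //.
      exact: measurableT_comp.
    + apply: emeasurable_funM => //; apply/measurable_EFinP.
      by apply: measurableT_comp => //; exact: integ_meas fi'.
    + move=> t _; rewrite -ge0_integralZl//; last first.
        apply/measurable_EFinP/measurableT_comp => //; exact: integ_meas wi'.
      apply: ge0_le_integral => //.
      * apply: measurableT_comp => //; apply: measurableT_comp => //.
        exact: (measurable_fun_pair2 t mF0).
      * apply: emeasurable_funM => //; apply/measurable_EFinP.
        apply/measurableT_comp => //; exact: integ_meas wi'.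
      * move=> s _; rewrite -EFinM lee_fin /F/= !normrM.
        by case: ifP => _; rewrite ?normr1 ?mulr1// normr0 mulr0 mulr_ge0.
  have wf : (\int[mu]_s `|w' s|%:E)%E \is a fin_num.
    by apply: integrable_fin_num => //; exact: (integrable_norm wi').
  rewrite -(fineK wf); under eq_integral do rewrite muleC.
  have /integrable_lty := integZ (fine (\int[mu]_s `|w' s|%:E)%E) measurableT
    (integrable_norm fi').
  exact.
have in1 t : (\int[mu]_s (F (t, s))%:E = (f' t * \int[mu]_(s in `[a, t]) w s)%:E)%E.
  have [tac|tac] := boolP (t \in `[a, c]); last first.
    have f0 : f' t = 0 by rewrite /f' patchE ifN// notin_setE/=; exact/negP.
    under eq_integral do rewrite /F/= f0 !mul0r.
    by rewrite integral0 f0 mul0r.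
  have -> : (fun s => (F (t, s))%:E) =
      EFin \o (fun s => f' t * (w \_ `[a, t]) s).
    apply/funext => s /=; congr EFin; rewrite /F/= -mulrA; congr *%R.
    rewrite /w' !patchE !mem_setE/= !in_itv/=; move: tac; rewrite in_itv/= => /andP[at_ tc].
    case: (leP a s) => as_ /=; last by rewrite mul0r.
    case: (leP s t) => st; rewrite ?mulr1 ?mulr0//.
    by rewrite (le_trans st tc).
  have wt : integ setT (w \_ `[a, t]).
    apply: (integ_restrict w _).1 => //; apply: integ_subitv wi => //.
    by move: tac; rewrite in_itv/= => /andP[].
  rewrite -[LHS]fineK; last by apply: integrable_fin_num => //; exact: integZ.
  congr EFin; rewrite [LHS]RintegralZl//.
  by rewrite [in RHS]Rintegral_mkcond.
have in2 s : (\int[mu]_t (F (t, s))%:E = (w' s * \int[mu]_(t in `[s, c]) f t)%:E)%E.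
  have [sac|sac] := boolP (s \in `[a, c]); last first.
    have w0 : w' s = 0 by rewrite /w' patchE ifN// notin_setE/=; exact/negP.
    under eq_integral do rewrite /F/= w0 mulr0 !mul0r.
    by rewrite integral0 w0 mul0r.
  have -> : (fun t => (F (t, s))%:E) =
      EFin \o (fun t => w' s * (f \_ `[s, c]) t).
    apply/funext => t /=; congr EFin; rewrite /F/= mulrAC [RHS]mulrC; congr *%R.
    rewrite /f' !patchE !mem_setE/= !in_itv/=; move: sac; rewrite in_itv/= => /andP[as_ sc].
    case: (leP s t) => st; rewrite ?mulr1 ?mulr0//.
    by rewrite (le_trans as_ st).
  have fs : integ setT (f \_ `[s, c]).
    apply: (integ_restrict f _).1 => //; apply: integ_subitv fi => //.
    by move: sac; rewrite in_itv/= => /andP[].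
  rewrite -[LHS]fineK; last by apply: integrable_fin_num => //; exact: integZ.
  congr EFin; rewrite [LHS]RintegralZl//.
  by rewrite [in RHS]Rintegral_mkcond.
have := Fubini Fi; rewrite /=.
under eq_integral do rewrite in1.
under [X in _ = X -> _]eq_integral do rewrite in2.
move=> /(congr1 fine) H.
rewrite Rintegral_mkcond [RHS]Rintegral_mkcond.
transitivity (\int[mu]_t (f' t * \int[mu]_(s in `[a, t]) w s)).
  apply: eq_Rintegral => t _; rewrite /f' !patchE; case: ifP => // _; by rewrite mul0r.
transitivity (\int[mu]_s (w' s * \int[mu]_(t in `[s, c]) f t)); first exact: H.
by apply: eq_Rintegral => t _; rewrite /w' !patchE; case: ifP => // _; rewrite mul0r.
Qed.
End Primitives.

(** * Weak derivatives of primitives *)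

Section WeakDerivatives.
Context {R : realType}.
Local Open Scope classical_set_scope.
Local Open Scope ring_scope.
Local Notation mu := (@lebesgue_measure R).
Local Notation integ D f := (mu.-integrable D (EFin \o f)).
Implicit Types (a b c t : R) (f g w phi : R -> R).

Lemma Rintegral_oo_cc a b f : integ `]a, b[ f ->
  \int[mu]_(t in `]a, b[) f t = \int[mu]_(t in `[a, b]) f t.
Proof.
move=> fi; rewrite Rintegral_itv_bndo_bndc// Rintegral_itv_obnd_cbnd//.
move/integ_oo_cc : fi; apply: integrableS => //.
by apply: subset_itv; rewrite bnd_simp.
Qed.

Lemma Rintegral_derive1 s t phi : (forall x, derivable phi x 1) -> continuous (derive1 phi) ->
  s <= t -> \int[mu]_(x in `[s, t]) derive1 phi x = phi t - phi s.
Proof.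
move=> dphi cphi; rewrite le_eqVlt => /predU1P[->|st]; first by rewrite Rintegral_itv1 subrr.
have cp : continuous phi.
  by move=> x; apply: differentiable_continuous; apply/derivable1_diffP; exact: dphi.
have dF : derivable_oo_LRcontinuous phi s t.
  split => //; [exact: cvg_at_right_filter (cp s)|exact: cvg_at_left_filter (cp t)].
have cF : {within `[s, t], continuous (derive1 phi)} by exact: continuous_subspaceT.
have H := continuous_FTC2 st cF dF (fun x _ => erefl).
by have /= := congr1 fine H.
Qed.

(** Two successive integrations become one; this is where the kernel t - s of
    the Volterra equation comes from. *)
Lemma Cauchy_repeated_integral a t w : a <= t -> integ `[a, t] w ->
  \int[mu]_(s in `[a, t]) ((t - s) * w s) =
  \int[mu]_(s in `[a, t]) \int[mu]_(r in `[a, s]) w r.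
Proof.
move=> at_ wi; have := Fubini_triangle wi (integ_cst a t 1).
under eq_Rintegral do rewrite mul1r.
move=> ->; apply: eq_Rintegral => s; rewrite inE/= in_itv/= => /andP[_ st].
by rewrite Rintegral_itv_cst// mul1r mulrC.
Qed.

Lemma C1c_vanish a b phi : C1c a b phi -> phi a = 0 /\ phi b = 0.
Proof.
move=> [_ _ [c [d [ac db z]]]]; split; apply: z; rewrite in_itv/= -?ltNge.
  by rewrite negb_and -ltNge ac.
by rewrite negb_and -!ltNge db orbT.
Qed.

Lemma C1c_continuous a b phi : C1c a b phi -> continuous phi.
Proof.
move=> [d _ _] x; apply: differentiable_continuous; exact/derivable1_diffP.
Qed.

(** The boundary terms of the integration by parts vanish because the test
    function does at both ends. *)
Lemma weak_derivative_prim a c w g B : L2_real a c w ->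
  (forall t, t \in `]a, c[ -> g t = B + \int[mu]_(s in `[a, t]) w s) ->
  weak_derivative_real a c g w.
Proof.
move=> w2 gE; have wi := L2_integ w2.
pose G t := B + \int[mu]_(s in `[a, t]) w s.
have cG : {within `[a, c], continuous G}.
  by move=> t; apply: cvgD; [exact: cvg_cst|exact: prim_continuous].
have g2 : L2_real a c g.
  have [mG i2] := (L2_realP _ _ _).1 (cont_L2 cG).
  apply/L2_realP; split.
    by apply: eq_measurable_fun mG => t; rewrite inE/= => /gE.
  by apply: eq_integrable i2 => // t; rewrite inE/= => /gE ->.
split => // phi hphi; have [dphi cphi _] := hphi.
have [pa pc] := C1c_vanish hphi.
have cp := C1c_continuous hphi.
have [ac|ca] := leP a c; last first.
  by rewrite set_itv_ge ?bnd_simp -?leNgt ?ltW// !Rintegral_set0 oppr0.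
have p2 : L2_real a c phi by apply: cont_L2; exact: continuous_subspaceT.
have dp2 : L2_real a c (derive1 phi) by apply: cont_L2; exact: continuous_subspaceT.
have dpi := L2_integ dp2.
transitivity (\int[mu]_(x in `]a, c[) (G x * derive1 phi x)).
  by apply: eq_Rintegral => t; rewrite inE/= => /gE ->.
rewrite !Rintegral_oo_cc; [|exact: integ_mul_L2|exact: integ_mul_L2 (cont_L2 cG) _].
transitivity (\int[mu]_(x in `[a, c]) (B * derive1 phi x
    + derive1 phi x * \int[mu]_(s in `[a, x]) w s)).
  by apply: eq_Rintegral => t _; rewrite /G mulrDl; congr +%R; rewrite mulrC.
rewrite RintegralD//; last 2 first.
- exact: integZ.
- apply/integ_oo_cc; apply: integ_mul_L2 => //.
  by apply: cont_L2; exact: prim_continuous.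
rewrite RintegralZl// Rintegral_derive1// pa pc subrr mulr0 add0r Fubini_triangle//.
transitivity (\int[mu]_(s in `[a, c]) (- 1 * (w s * phi s))).
  apply: eq_Rintegral => s; rewrite inE/= in_itv/= => /andP[_ sc].
  by rewrite Rintegral_derive1// pc sub0r mulrN mulN1r.
rewrite RintegralZl ?mulN1r//; apply/integ_oo_cc; exact: integ_mul_L2.
Qed.

End WeakDerivatives.

(** * The du Bois-Reymond lemma *)

Section Ramps.
Context {R : realType}.
Local Open Scope classical_set_scope.
Local Open Scope ring_scope.
Local Notation mu := (@lebesgue_measure R).
Local Notation integ D f := (mu.-integrable D (EFin \o f)).
Implicit Types (a b c t s e x : R) (f g w phi : R -> R).

(** An explicit second-order bound on the increments identifies the derivative
    also at the points where the second derivative jumps. *)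
Lemma derive_quadratic f x l C :
  (forall h, `|f (x + h) - f x - h * l| <= C * h ^+ 2) ->
  derivable f x 1 /\ derive1 f x = l.
Proof.
move=> fC.
have C0 : 0 <= C.
  by have := fC 1; rewrite expr1n mulr1; exact: le_trans.
have lim : (fun h : R => h^-1 *: (f (h + x) - f x)) @ 0^' --> l.
  apply/cvgrPdist_le => e e0.
  near=> h.
  have hn0 : h != 0 by near: h; exact: nbhs_dnbhs_neq.
  have -> : l - h^-1 *: (f (h + x) - f x) = - (h^-1 * (f (x + h) - f x - h * l)).
    rewrite (_ : _ *: _ = h^-1 * (f (h + x) - f x))// (addrC h).
    by field.
  rewrite normrN normrM normfV ler_pdivrMl ?normr_gt0//.
  apply: le_trans (fC h) _.
  rewrite -(real_normK (num_real h)) expr2 mulrA mulrC ler_wpM2l//.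
  have he : `|h| <= e / (C + 1).
    near: h; apply: dnbhs0_le; apply: divr_gt0 => //; lra.
  rewrite (le_trans (ler_wpM2l C0 he))// mulrA ler_pdivrMr; nra.
split; last exact: cvg_lim lim.
apply/cvg_ex; exists l; move: lim; rewrite /=.
set g := (X in X @ _ --> _); set k := (X in _ -> X @ _ --> _).
suff -> : g = k by [].
by apply/funext => h; rewrite /g /k /= [_%:A]mulr1.
Unshelve. all: by end_near. Qed.

Definition pospart x := Num.max x 0.

Lemma pospart_id x : 0 <= x -> pospart x = x. Proof. by move=> h; apply/max_idPl. Qed.

Lemma pospart_eq0 x : x <= 0 -> pospart x = 0. Proof. by move=> h; apply/max_idPr. Qed.

Lemma pospart_continuous : continuous pospart.
Proof. by move=> x; apply: continuous_max; [exact: cvg_id|exact: cvg_cst]. Qed.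

(** The square of the positive part is C^1; test functions are built from it
    because their derivatives are piecewise linear. *)
Lemma pospart_sqr_quadratic x h :
  `|pospart (x + h) ^+ 2 - pospart x ^+ 2 - h * (2 * pospart x)| <= 1 * h ^+ 2.
Proof.
rewrite ler_norml.
have [h1|h1] := leP 0 (x + h); have [h2|h2] := leP 0 x.
- by rewrite !pospart_id//; apply/andP; split; nra.
- by rewrite pospart_id// (pospart_eq0 (ltW h2)); apply/andP; split; nra.
- by rewrite (pospart_eq0 (ltW h1)) pospart_id//; apply/andP; split; nra.
- by rewrite (pospart_eq0 (ltW h1)) (pospart_eq0 (ltW h2)); apply/andP; split; nra.
Qed.

(** Continuous approximation of the indicator of ]s, +oo[ as e tends to 0. *)
Definition ramp s e x := (pospart (x - s) - pospart (x - s - e)) / e.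

(** The primitive of the ramp that vanishes to the left of s. *)
Definition ramp_prim s e x := (pospart (x - s) ^+ 2 - pospart (x - s - e) ^+ 2) / (2 * e).

Lemma ramp_left s e x : 0 < e -> x <= s -> ramp s e x = 0.
Proof. by move=> e0 xs; rewrite /ramp !pospart_eq0 ?subrr ?mul0r//; lra. Qed.

Lemma ramp_right s e x : 0 < e -> s + e <= x -> ramp s e x = 1.
Proof. by move=> e0 xs; rewrite /ramp !pospart_id; [field|..]; lra. Qed.

Lemma ramp_itv s e x : 0 < e -> 0 <= ramp s e x <= 1.
Proof.
move=> e0; have [xs|sx] := leP x s; first by rewrite ramp_left// lexx ler01.
have [ex|xe] := leP (s + e) x; first by rewrite ramp_right// lexx ler01.
rewrite /ramp pospart_id; last lra.
by rewrite pospart_eq0 ?subr0; last lra; rewrite divr_ge0/= ?ler_pdivrMr//; lra.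
Qed.

Lemma ramp_prim_left s e x : 0 < e -> x <= s -> ramp_prim s e x = 0.
Proof. by move=> e0 xs; rewrite /ramp_prim !pospart_eq0 ?subrr ?mul0r//; lra. Qed.

Lemma ramp_prim_right s e x : 0 < e -> s + e <= x -> ramp_prim s e x = x - s - e / 2.
Proof. by move=> e0 xs; rewrite /ramp_prim !pospart_id; [field|..]; lra. Qed.

Lemma ramp_continuous s e : continuous (ramp s e).
Proof.
have c k : continuous (fun x => pospart (x - k)).
  move=> y; apply: (@continuous_comp _ _ _ (fun x => x - k) pospart); last exact: pospart_continuous.
  by apply: cvgB; [exact: cvg_id|exact: cvg_cst].
move=> x; apply: cvgM; last exact: cvg_cst.
apply: cvgB; first exact: c.
under eq_fun do rewrite -addrA -opprD.
by rewrite -addrA -opprD; exact: c.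
Qed.

Lemma ramp_prim_quadratic s e x h : 0 < e ->
  `|ramp_prim s e (x + h) - ramp_prim s e x - h * ramp s e x| <= e^-1 * h ^+ 2.
Proof.
move=> e0.
have q1 := pospart_sqr_quadratic (x - s) h; have q2 := pospart_sqr_quadratic (x - s - e) h.
have -> : ramp_prim s e (x + h) - ramp_prim s e x - h * ramp s e x =
  ((pospart (x - s + h) ^+ 2 - pospart (x - s) ^+ 2 - h * (2 * pospart (x - s))) -
   (pospart (x - s - e + h) ^+ 2 - pospart (x - s - e) ^+ 2 -
    h * (2 * pospart (x - s - e)))) / (2 * e).
  rewrite /ramp_prim /ramp (_ : x + h - s = x - s + h); last by ring.
  rewrite (_ : x - s + h - e = x - s - e + h); last by ring.
  by field; lra.
rewrite normrM normfV (gtr0_norm (_ : 0 < 2 * e)); last lra.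
rewrite ler_pdivrMr; last lra.
rewrite (_ : e^-1 * h ^+ 2 * (2 * e) = 1 * h ^+ 2 + 1 * h ^+ 2); last by field; lra.
by rewrite (le_trans (ler_normB _ _))// lerD.
Qed.

Lemma ramp_cvg s x (e : R) : 0 < e ->
  ramp s (e * n.+1%:R^-1) x @[n --> \oo] --> (if s < x then 1 else 0 : R).
Proof.
move=> e0; have en (n : nat) : 0 < e * n.+1%:R^-1 by rewrite mulr_gt0.
have [sx|xs] := ltP s x; last first.
  apply: cvg_near_cst; apply: nearW => n; exact: ramp_left.
have h0 : 0 < (x - s) / e by rewrite divr_gt0// subr_gt0.
apply: cvg_near_cst; near=> n; apply: ramp_right => //.
have h : n.+1%:R^-1 < (x - s) / e.
  by near: n; exact: (near_infty_natSinv_lt (PosNum h0)).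
by rewrite -lerBrDl ltW// mulrC -ltr_pdivlMr.
Unshelve. all: by end_near. Qed.

(** Ramps take values in [0, 1], so |f| dominates. *)
Lemma ramp_integral_cvg f s e : 0 < e -> integ setT f ->
  \int[mu]_x (f x * ramp s (e * n.+1%:R^-1) x) @[n --> \oo]
    --> \int[mu]_(x in `]s, +oo[) f x.
Proof.
move=> e0 fi; have en (n : nat) : 0 < e * n.+1%:R^-1 by rewrite mulr_gt0.
have mf := integ_meas fi.
have mr n : measurable_fun setT (ramp s (e * n.+1%:R^-1)).
  by apply: continuous_measurable_fun; exact: ramp_continuous.
pose F n x := (f x * ramp s (e * n.+1%:R^-1) x)%:E.
pose L x := (f x * (if s < x then 1 else 0))%:E.
have mF n : measurable_fun setT (F n).
  by apply/measurable_EFinP; apply: measurable_funM.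
have FL x : F ^~ x @ \oo --> L x.
  apply: cvg_EFin; first exact: nearW.
  by apply: cvgM; [exact: cvg_cst|exact: ramp_cvg].
have mL : measurable_fun setT L.
  by apply: (emeasurable_fun_cvg F) => // x _; exact: FL.
have Fb x n : (`|F n x| <= `|(f x)%:E|)%E.
  rewrite /F abse_EFin lee_fin normrM.
  have /andP[r0 r1] := ramp_itv s x (en n).
  by rewrite (ger0_norm r0) ler_piMr.
have [|||iL _ cv] := @dominated_convergence _ _ _ mu setT measurableT F L
    (abse \o (EFin \o f)) mF mL.
- by apply: aeW => x _; exact: FL.
- exact: integrable_abse.
- by apply: aeW => x n _; exact: Fb.
have EL : (\int[mu]_x L x)%E = (\int[mu]_(x in `]s, +oo[) f x)%:E.
  rewrite -[LHS]fineK ?integrable_fin_num//; congr EFin.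
  rewrite [RHS]Rintegral_mkcond; apply: eq_Rintegral => x _.
  rewrite patchE mem_setE in_itv/= andbT.
  by case: ifP; rewrite ?mulr1 ?mulr0.
by move: cv; rewrite EL => /fine_cvg.
Qed.

End Ramps.

Section DuBoisReymond.
Context {R : realType}.
Local Open Scope classical_set_scope.
Local Open Scope ring_scope.
Local Notation mu := (@lebesgue_measure R).
Local Notation integ D f := (mu.-integrable D (EFin \o f)).
Implicit Types (a b c t s e x : R) (f g w phi : R -> R).

Lemma derive1_eq_in a c f g t : t \in `]a, c[ -> {in `]a, c[, f =1 g} ->
  derive1 f t = derive1 g t.
Proof.
move=> tac fg; rewrite !derive1E; apply: near_eq_derive.
by have := near_in_itvoo tac; apply: filterS => y /fg.
Qed.

Lemma derive1_eq_val_in a b f g t l : t \in `]a, b[ -> {in `]a, b[, f =1 g} ->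
  derivable g t 1 /\ derive1 g t = l -> derivable f t 1 /\ derive1 f t = l.
Proof.
move=> tab fg [dg gl]; rewrite (derive1_eq_in tab fg); split => //.
apply: near_eq_derivable dg.
by have := near_in_itvoo tab; apply: filterS => y /fg.
Qed.

(** The coefficients c_i = s3 - s2, - (s3 - s1), s2 - s1 satisfy sum c_i = 0 and
    sum c_i s_i = 0. To the right of the ramps their combined primitive is
    sum c_i (x - s_i - e / 2), hence 0, and the support is compact. *)
Lemma three_ramps_C1c a c s1 s2 s3 e : a < s1 -> s1 < s2 -> s2 < s3 ->
  0 < e -> s3 + e < c ->
  let phi x := (s3 - s2) * ramp_prim s1 e x - (s3 - s1) * ramp_prim s2 e x
                 + (s2 - s1) * ramp_prim s3 e x in
  let psi x := (s3 - s2) * ramp s1 e x - (s3 - s1) * ramp s2 e x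
                 + (s2 - s1) * ramp s3 e x in
  C1c a c phi /\ derive1 phi = psi.
Proof.
move=> as1 s12 s23 e0 s3c phi psi.
have D x : derivable phi x 1 /\ derive1 phi x = psi x.
  apply: (@derive_quadratic _ _ _ _ (((s3 - s2) + (s3 - s1) + (s2 - s1)) * e^-1)) => h.
  have /ler_normlP[p1 q1] := ramp_prim_quadratic s1 x h e0.
  have /ler_normlP[p2 q2] := ramp_prim_quadratic s2 x h e0.
  have /ler_normlP[p3 q3] := ramp_prim_quadratic s3 x h e0.
  rewrite ler_norml /phi /psi; apply/andP; split; nra.
have dE : derive1 phi = psi by apply/funext => x; have [] := D x.
split; last exact: dE.
split.
- by move=> x; have [] := D x.
- rewrite dE => x; rewrite /psi.
  apply: cvgD; first apply: cvgB; apply: cvgM; (try exact: cvg_cst); exact: ramp_continuous.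
- exists s1, (s3 + e); split => // x.
  rewrite in_itv/= negb_and -!ltNge => /orP[h|h].
    by rewrite /phi !ramp_prim_left//; [ring|lra..].
  by rewrite /phi !ramp_prim_right//; [ring|lra..].
Qed.

(** Three ramps whose width tends to 0 turn the hypothesis on test functions
    into a statement about integrals over half-lines: the tail T is affine
    on ]a, c[. *)
Lemma three_tails a c f s1 s2 s3 : a < s1 -> s1 < s2 -> s2 < s3 -> s3 < c ->
  integ `]a, c[ f ->
  (forall phi, C1c a c phi -> \int[mu]_(x in `]a, c[) (f x * derive1 phi x) = 0) ->
  let T s := \int[mu]_(x in `]s, +oo[) (f \_ `]a, c[) x in
  (s3 - s2) * T s1 - (s3 - s1) * T s2 + (s2 - s1) * T s3 = 0.
Proof.
move=> as1 s12 s23 s3c fi h T.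
pose G : R -> R := f \_ `]a, c[.
have Gi : integ setT G by apply: (integ_restrict f _).1 => //.
(* e0 is small enough for all the ramps to end before c. *)
pose e0 := (c - s3) / 2; have e00 : 0 < e0 by rewrite /e0; lra.
pose e (n : nat) := e0 * n.+1%:R^-1.
have e_gt0 n : 0 < e n by rewrite mulr_gt0.
have e_le n : e n <= e0 by rewrite /e ler_pdivrMr//; apply: ler_peMr; [exact: ltW|rewrite ler1n].
have Ir s n : integ setT (fun x => G x * ramp s (e n) x).
  apply: (@integ_mul_bounded _ _ _ _ 1) => //.
    by apply: continuous_measurable_fun; exact: ramp_continuous.
  by move=> x _; have /andP[r0 r1] := ramp_itv s x (e_gt0 n); rewrite ger0_norm.
pose J s n := \int[mu]_x (G x * ramp s (e n) x).
have Z n : (s3 - s2) * J s1 n - (s3 - s1) * J s2 n + (s2 - s1) * J s3 n = 0.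
  have s3e : s3 + e n < c by have := e_le n; rewrite /e0; lra.
  have [C E] := three_ramps_C1c as1 s12 s23 (e_gt0 n) s3e.
  have := h _ C; rewrite E Rintegral_mkcond.
  rewrite /J -!RintegralZl// -RintegralB//; [|exact: integZ..].
  rewrite -RintegralD//; [|by apply: integB => //; exact: integZ|exact: integZ].
  move=> <-; apply: eq_Rintegral => x _; rewrite /G !patchE; case: ifP => _; first by ring.
  by rewrite !mul0r !mulr0 subrr addr0.
have cv : (s3 - s2) * J s1 n - (s3 - s1) * J s2 n + (s2 - s1) * J s3 n @[n --> \oo] -->
    (s3 - s2) * T s1 - (s3 - s1) * T s2 + (s2 - s1) * T s3.
  apply: cvgD; first apply: cvgB; apply: cvgM; (try exact: cvg_cst); exact: ramp_integral_cvg.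
by move: cv; under eq_fun do rewrite Z; move=> /(cvg_lim (@Rhausdorff R)) <-; rewrite lim_cst.
Qed.

(** By [three_tails] a primitive of f is affine on ]a, c[, and by Lebesgue's
    differentiation theorem f is almost everywhere the derivative of its
    primitive. *)
Lemma du_Bois_Reymond a c f : integ `]a, c[ f ->
  (forall phi, C1c a c phi -> \int[mu]_(x in `]a, c[) (f x * derive1 phi x) = 0) ->
  exists k, {ae mu, forall t, t \in `]a, c[ -> f t = k}.
Proof.
move=> fi h; have [ac|ca] := ltP a c; last first.
  by exists 0; apply: aeW => t; rewrite in_itv/= => /andP[]; lra.
pose G : R -> R := f \_ `]a, c[.
have Gi : integ setT G by apply: (integ_restrict f _).1 => //.
pose F t := \int[mu]_(x in `]-oo, t]) G x.
have TF s : \int[mu]_(x in `]s, +oo[) G x = \int[mu]_x G x - F s.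
  by rewrite -(@Rintegral_itvB _ G -oo%O +oo%O s)// set_itvE.
have F3 s1 s2 s3 : a < s1 -> s1 < s2 -> s2 < s3 -> s3 < c ->
    (s3 - s2) * F s1 - (s3 - s1) * F s2 + (s2 - s1) * F s3 = 0.
  move=> h1 h2 h3 h4; have := three_tails h1 h2 h3 h4 fi h.
  by rewrite /= -/G !TF; lra.
(* Two interior points, through which the affine primitive is drawn. *)
pose s0 := (2 * a + c) / 3; pose s1 := (a + 2 * c) / 3.
have [as0 s01 s1c] : [/\ a < s0, s0 < s1 & s1 < c] by rewrite /s0 /s1; split; lra.
pose k := (F s1 - F s0) / (s1 - s0).
have Fk t : t \in `]a, c[ -> F t = F s0 + (t - s0) * k.
  rewrite in_itv/= => /andP[at_ tc].
  suff : F t * (s1 - s0) = F s0 * (s1 - s0) + (t - s0) * (F s1 - F s0).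
    by move=> E; apply: (@mulIf _ (s1 - s0)); [lra|rewrite E /k; field; lra].
  have [t0|t0|->] := ltgtP t s0; last by ring.
    by have := F3 _ _ _ at_ t0 s01 s1c; lra.
  have [t1|t1|->] := ltgtP t s1; last by ring.
    by have := F3 _ _ _ as0 t0 t1 s1c; lra.
  by have := F3 _ _ _ as0 s01 t1 tc; lra.
exists k.
have loc : locally_integrable [set: R] G by exact: integrable_locally.
have iy y : integ `]-oo, y] G by apply: integrableS Gi.
have := FTC1Ny iy loc; apply: filterS; first exact: (ae_filter_ringOfSetsType mu).
move=> t [_ Ft] tac.
have : derivable F t 1 /\ derive1 F t = k.
  apply: (derive1_eq_val_in tac Fk).
  apply: (@derive_quadratic _ _ _ _ 0) => u.
  by rewrite (_ : _ - _ - _ = 0) ?normr0 ?mul0r//; ring.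
by move=> [_]; rewrite Ft /G patchE mem_setE tac.
Qed.

End DuBoisReymond.

(** * Taylor's formula for weak derivatives *)

Section Representation.
Context {R : realType}.
Local Open Scope classical_set_scope.
Local Open Scope ring_scope.
Local Notation mu := (@lebesgue_measure R).
Local Notation integ D f := (mu.-integrable D (EFin \o f)).
Implicit Types (a b c t s e x : R) (f g w phi : R -> R).

(** Taylor's formula at a with integral remainder, where w stands for the second
    derivative. *)
Definition taylor_form a c w (A S : R) f := forall t, t \in `[a, c] ->
  f t = A + S * (t - a) + \int[mu]_(s in `[a, t]) ((t - s) * w s).

Lemma AC_continuous a b f : AC_real a b f -> {within `[a, b], continuous f}.
Proof.
move=> ac; apply/subspace_continuousP => x /=; rewrite in_itv/= => xab.
apply/cvgrPdist_lt => e e0; have [d d0 H] := ac e e0.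
have Hst s t : a <= s -> s <= t -> t <= b -> t - s < d -> `|f t - f s| < e.
  move=> as_ st tb tsd; have := H 1 (fun=> s) (fun=> t).
  rewrite !big_ord1; apply => //; move=> i j _ _ _; by rewrite !ord1.
near=> t.
have tab : a <= t <= b.
  by near: t; apply: withinT; exact: nbhs_filter.
have tx : `|x - t| < d.
  near: t; apply: cvg_within; exact: nbhsx_ballx.
move: xab tab => /andP[ax xb] /andP[at_ tb].
have [xt|tx'] := leP x t.
  by rewrite distrC; apply: Hst => //; move: tx; rewrite distrC ger0_norm ?subr_ge0.
by apply: Hst => //; [exact: ltW|move: tx; rewrite gtr0_norm ?subr_gt0].
Unshelve. all: by end_near. Qed.

Lemma lipschitz_AC a b f M :
  (forall s t, a <= s -> s <= t -> t <= b -> `|f t - f s| <= M * (t - s)) ->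
  AC_real a b f.
Proof.
move=> H e e0.
have M0 : 0 < `|M| + 1 by rewrite ltr_wpDl.
exists (e / (`|M| + 1)); first exact: divr_gt0.
move=> n s t st _ sd.
apply: (@le_lt_trans _ _ (\sum_(i < n) (`|M| + 1) * (t i - s i))).
  apply: ler_sum => i _; have [h1 h2 h3] := st i.
  apply: (le_trans (H _ _ h1 h2 h3)); apply: ler_wpM2r; first by rewrite subr_ge0.
  by rewrite (le_trans (ler_norm _))// lerDl.
by rewrite -mulr_sumr mulrC -ltr_pdivlMr.
Qed.

Lemma ae_eq_Rintegral a c f g : measurable_fun `[a, c] f -> measurable_fun `[a, c] g ->
  {ae mu, forall t, t \in `]a, c[ -> f t = g t} ->
  \int[mu]_(t in `[a, c]) f t = \int[mu]_(t in `[a, c]) g t.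
Proof.
move=> mf mg fg.
have oo : `]a, c[ `<=` `[a, c] by exact: subset_itv_oo_cc.
have mf' : measurable_fun `]a, c[ f by exact: measurable_funS mf.
have mg' : measurable_fun `]a, c[ g by exact: measurable_funS mg.
have E h : measurable_fun `]a, c[ h ->
   \int[mu]_(t in `[a, c]) h t = \int[mu]_(t in `]a, c[) h t.
  move=> mh; congr fine.
  by apply: (@integral_itv_bndoo R a c (EFin \o h) true false); exact/measurable_EFinP.
rewrite !E//; congr fine; apply: ae_eq_integral => //.
- exact/measurable_EFinP.
- exact/measurable_EFinP.
- apply: filterS fg; first exact: (ae_filter_ringOfSetsType mu).
  by move=> t h tac; rewrite h.
Qed.

(** The difference has a zero primitive, and a continuous function is the
    derivative of its primitive inside the interval; limits settle the end
    points. *)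
Lemma ae_eq_continuous a c f g : a < c -> {within `[a, c], continuous f} ->
  {within `[a, c], continuous g} ->
  {ae mu, forall t, t \in `]a, c[ -> f t = g t} -> {in `[a, c], f =1 g}.
Proof.
move=> ac cf cg fg; pose D t := f t - g t.
have cD : {within `[a, c], continuous D} by move=> t; apply: cvgB; [exact: cf|exact: cg].
have [cDo cDl cDr] := (continuous_within_itvP _ ac).1 cD.
have Do t : t \in `]a, c[ -> D t = 0.
  move=> tac; move: (tac); rewrite in_itv/= => /andP[at_ tc].
  have [_ dF] := continuous_FTC1_closed tc (cont_integ cD) at_ (cDo t tac).
  rewrite -dF.
  have F0 : {in `]a, c[, (fun x => \int[mu]_(t in `[a, x]) D t) =1 cst 0}.
    move=> x; rewrite in_itv/= => /andP[ax xc] /=.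
    have sub : `[a, x] `<=` `[a, c] by apply: subset_itvl; rewrite bnd_simp ltW.
    rewrite (@ae_eq_Rintegral a x D (cst 0)); first last.
    - apply: filterS fg; first exact: (ae_filter_ringOfSetsType mu).
      move=> y /= h; rewrite in_itv/= => /andP[ay yx].
      by rewrite /D h ?subrr// in_itv/= ay (lt_trans yx).
    - exact: measurable_cst.
    - by apply: measurable_funS (cont_meas cD).
    by rewrite Rintegral_itv_cst ?mul0r// ltW.
  have [] // := @derive1_eq_val_in _ _ _ _ (cst 0) t 0 tac F0.
  by split; [exact: derivable_cst|rewrite derive1_cst].
suff D0 t : t \in `[a, c] -> D t = 0.
  by move=> t /D0/eqP; rewrite subr_eq0 => /eqP.
rewrite in_itv/= => /andP[]; rewrite le_eqVlt => /predU1P[<- _|at_].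
  have : D y @[y --> a^'+] --> 0.
    apply: cvg_near_cst; near=> y; apply: Do; rewrite in_itv/=; apply/andP; split => //.
  by move/(cvg_lim (@Rhausdorff R)) <-; rewrite (cvg_lim (@Rhausdorff R) cDl).
rewrite le_eqVlt => /predU1P[->|tc]; last by apply: Do; rewrite in_itv/= at_.
have : D y @[y --> c^'-] --> 0.
  by apply: cvg_near_cst; near=> y; apply: Do; rewrite in_itv/=; apply/andP; split => //.
by move/(cvg_lim (@Rhausdorff R)) <-; rewrite (cvg_lim (@Rhausdorff R) cDr).
Unshelve. all: by end_near. Qed.

(** Subtract from f the primitive of g, whose weak derivative is g as well: what
    remains has zero weak derivative. *)
Lemma weak_derivative_is_prim a c f g : weak_derivative_real a c f g ->
  exists k, {ae mu, forall t, t \in `]a, c[ -> f t = k + \int[mu]_(s in `[a, t]) g s}.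
Proof.
move=> [f2 g2 fg].
pose W t := \int[mu]_(s in `[a, t]) g s.
have cW : {within `[a, c], continuous W} by apply: prim_continuous; exact: L2_integ.
have W2 := cont_L2 cW.
have [_ _ Wg] : weak_derivative_real a c W g.
  by apply: (@weak_derivative_prim _ _ _ _ _ 0) => // t _; rewrite add0r.
have [|phi hphi|k hk] := @du_Bois_Reymond _ a c (fun t => f t - W t).
- by apply: integB => //; exact: L2_integ_oo.
- have [dphi cphi _] := hphi.
  have dp2 : L2_real a c (derive1 phi) by apply: cont_L2; exact: continuous_subspaceT.
  transitivity (\int[mu]_(x in `]a, c[) (f x * derive1 phi x - W x * derive1 phi x)).
    by apply: eq_Rintegral => t _; rewrite mulrBl.
  by rewrite RintegralB// ?fg ?Wg ?subrr//; exact: integ_mul_L2.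
- exists k; apply: filterS hk; first exact: (ae_filter_ringOfSetsType mu).
  by move=> t h tac; rewrite -(h tac) subrK.
Qed.

Lemma remainder_continuous a c w : integ `[a, c] w ->
  {within `[a, c], continuous (fun t => \int[mu]_(s in `[a, t]) ((t - s) * w s))}.
Proof.
move=> wi; have h := prim_continuous (cont_integ (prim_continuous wi)).
apply: subspace_eq_continuous h => t.
 rewrite inE/= in_itv/= => /andP[at_ tc].
by rewrite /from_subspace Cauchy_repeated_integral//; exact: integ_subitv wi.
Qed.

(** Each of the two integrations holds almost everywhere only; the continuity of
    f extends their outcome to the closed segment. *)
Lemma weak_taylor a c f v w : a < c -> {within `[a, c], continuous f} ->
  weak_derivative_real a c f v -> weak_derivative_real a c v w ->
  exists S, taylor_form a c w (f a) S f.
Proof.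
move=> ac cf fv vw; have [_ v2 _] := fv; have [_ w2 _] := vw.
have vi := L2_integ v2; have wi := L2_integ w2.
have [S vE] := weak_derivative_is_prim vw; have [A fE] := weak_derivative_is_prim fv.
pose g t := A + S * (t - a) + \int[mu]_(s in `[a, t]) ((t - s) * w s).
have cW := prim_continuous wi.
have vI t : a <= t -> t <= c -> \int[mu]_(s in `[a, t]) v s =
    S * (t - a) + \int[mu]_(s in `[a, t]) ((t - s) * w s).
  move=> at_ tc; have sub : `[a, t] `<=` `[a, c] by apply: subset_itvl; rewrite bnd_simp.
  have iW : integ `[a, t] (fun s => \int[mu]_(r in `[a, s]) w r).
    by apply: integ_subitv (cont_integ cW).
  rewrite Cauchy_repeated_integral//; last exact: integ_subitv wi.
  rewrite -Rintegral_itv_cst// -RintegralD//; last exact: integ_cst.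
  apply: ae_eq_Rintegral.
  - by apply: measurable_funS (integ_meas vi).
  - by apply: measurable_funD; [exact: measurable_cst|exact: integ_meas iW].
  - apply: filterS vE; first exact: (ae_filter_ringOfSetsType mu).
    move=> s h; rewrite in_itv/= => /andP[as_ st]; apply: h.
    by rewrite in_itv/= as_ (lt_le_trans st).
have cg : {within `[a, c], continuous g}.
  move=> t; apply: cvgD; last exact: remainder_continuous.
  apply: cvgD; first exact: cvg_cst.
  apply: cvgM; first exact: cvg_cst.
  apply: cvgB; last exact: cvg_cst.
  exact: (@continuous_subspaceT _ _ `[a, c]%classic id (fun=> cvg_id)).
have fg : {in `[a, c], f =1 g}.
  apply: ae_eq_continuous => //.
  apply: filterS fE; first exact: (ae_filter_ringOfSetsType mu).
  move=> t h tac; rewrite h// /g -addrA vI//; move: tac; rewrite in_itv/= => /andP[*]; exact: ltW.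
exists S => t tac; rewrite (fg t tac) /g; congr (_ + _ + _).
have := fg a; rewrite in_itv/= lexx ltW// /g => -> //.
by rewrite subrr mulr0 Rintegral_itv1 !addr0.
Qed.

Lemma taylor_derive a c f w A S : integ `[a, c] w ->
  taylor_form a c w A S f ->
  forall t, t \in `]a, c[ ->
    derivable f t 1 /\ derive1 f t = S + \int[mu]_(s in `[a, t]) w s.
Proof.
move=> wi fE t tac; move: (tac); rewrite in_itv/= => /andP[at_ tc].
have ac := lt_trans at_ tc.
have cW := prim_continuous wi.
have [cWo _ _] := (continuous_within_itvP _ ac).1 cW.
have [dF1 dF2] := continuous_FTC1_closed tc (cont_integ cW) at_ (cWo t tac).
apply: (@derive1_eq_val_in _ _ _ _
  (fun t => A + S * (t - a) + \int[mu]_(s in `[a, t]) \int[mu]_(r in `[a, s]) w r) _ _ tac).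
  move=> s sac; rewrite fE; last exact: subset_itv_oo_cc.
  move: sac; rewrite in_itv/= => /andP[as_ sc].
  by rewrite Cauchy_repeated_integral ?ltW//; apply: integ_subitv wi => //; exact: ltW.
have d1 : is_derive t 1 (fun t => A + S * (t - a)) S.
  have : is_derive t (1 : R) (fun t => A + S * (t - a)) (0 + (S * (1 - 0))).
    exact: is_deriveD.
  by rewrite add0r subr0 mulr1.
have d2 : is_derive t 1 (fun t => \int[mu]_(s in `[a, t]) \int[mu]_(r in `[a, s]) w r)
    (\int[mu]_(s in `[a, t]) w s).
  by rewrite -dF2; rewrite derive1E; exact: derivableP.
have d := is_deriveD d1 d2.
by split; [exact: ex_derive|rewrite derive1E; exact: derive_val].
Qed.

Lemma taylor_weak a c f w A S : L2_real a c w ->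
  taylor_form a c w A S f ->
  let v t := S + \int[mu]_(s in `[a, t]) w s in
  weak_derivative_real a c f v /\ weak_derivative_real a c v w.
Proof.
move=> w2 fE v; have wi := L2_integ w2; have cW := prim_continuous wi.
have cv : {within `[a, c], continuous v}.
  by move=> t; apply: cvgD; [exact: cvg_cst|exact: cW].
split; last by apply: (@weak_derivative_prim _ _ _ _ _ S).
apply: (@weak_derivative_prim _ _ _ _ _ A); first exact: cont_L2.
move=> t tac; rewrite fE; last exact: subset_itv_oo_cc.
move: tac; rewrite in_itv/= => /andP[/ltW at_ /ltW tc].
rewrite Cauchy_repeated_integral//; last exact: integ_subitv wi.
rewrite -Rintegral_itv_cst// -addrA -RintegralD//; first exact: integ_cst.
by apply: integ_subitv (cont_integ cW).
Qed.

Lemma taylor_right a c f w A S : a < c -> integ `[a, c] w ->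
  taylor_form a c w A S f ->
  derive1 f t @[t --> a^'+] --> S.
Proof.
move=> ac wi fE; have cW := prim_continuous wi.
have [_ cl _] := (continuous_within_itvP _ ac).1 cW.
have : (S + \int[mu]_(s in `[a, t]) w s) @[t --> a^'+] --> S + 0.
  by apply: cvgD; [exact: cvg_cst|move: cl; rewrite Rintegral_itv1].
rewrite addr0; apply: cvg_trans; apply: near_eq_cvg.
near=> t; have [] // := taylor_derive wi fE (t := t).
by rewrite in_itv/=; apply/andP; split.
Unshelve. all: by end_near. Qed.

Lemma taylor_left a c f w A S : a < c -> integ `[a, c] w ->
  taylor_form a c w A S f ->
  derive1 f t @[t --> c^'-] --> S + \int[mu]_(s in `[a, c]) w s.
Proof.
move=> ac wi fE; have cW := prim_continuous wi.
have [_ _ cr] := (continuous_within_itvP _ ac).1 cW.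
have : (S + \int[mu]_(s in `[a, t]) w s) @[t --> c^'-] -->
    S + \int[mu]_(s in `[a, c]) w s.
  by apply: cvgD; [exact: cvg_cst|exact: cr].
apply: cvg_trans; apply: near_eq_cvg.
near=> t; have [] // := taylor_derive wi fE (t := t).
by rewrite in_itv/=; apply/andP; split.
Unshelve. all: by end_near. Qed.

Lemma taylor_lipschitz a c f w A S : integ `[a, c] w ->
  taylor_form a c w A S f ->
  exists M, forall s t, a <= s -> s <= t -> t <= c -> `|f t - f s| <= M * (t - s).
Proof.
move=> wi fE; have cW := prim_continuous wi.
have [M M0 WM] := cont_bounded cW.
exists (`|S| + M) => s t as_ st tc.
have at_ := le_trans as_ st; have sc := le_trans st tc.
rewrite !fE ?in_itv/= ?as_ ?sc ?at_ ?tc//.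
rewrite !Cauchy_repeated_integral//; [|exact: integ_subitv wi..].
have := prim_lipschitz WM (cont_integ cW) as_ st tc.
set X := Rintegral _ _ _; set Y := Rintegral _ _ _ => XY.
have -> : A + S * (t - a) + X - (A + S * (s - a) + Y) = S * (t - s) + (X - Y) by ring.
rewrite (le_trans (ler_normD _ _))// mulrDl lerD// normrM.
by rewrite (ger0_norm (_ : 0 <= t - s))// subr_ge0.
Qed.

End Representation.

(** * Translations of the line *)

Section Translation.
Context {R : realType}.
Local Open Scope classical_set_scope.
Local Open Scope ring_scope.
Local Notation mu := (@lebesgue_measure R).
Local Notation integ D f := (mu.-integrable D (EFin \o f)).
Implicit Types (a b c t s e x h : R) (f g w : R -> R).

Definition shift_by h : measurableTypeR R -> measurableTypeR R := fun s => s + h.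

Lemma shift_preimage h (l r : bool) (x y : R) :
  shift_by h @^-1` [set` Interval (BSide l x) (BSide r y)] =
  [set` Interval (BSide l (x - h)) (BSide r (y - h))].
Proof.
by case: l; case: r; apply/seteqP; split => s;
  rewrite /shift_by/= !in_itv/= ?(lerBlDr, ltrBlDr, lerBrDr, ltrBrDr).
Qed.

Lemma measurable_shift h : measurable_fun setT (shift_by h).
Proof. exact: measurable_funD. Qed.

Lemma lebesgue_shift h (A : set (measurableTypeR R)) : measurable A ->
  pushforward mu (shift_by h) A = mu A.
Proof.
move=> mA; apply/esym/lebesgue_measure_unique => //=; first exact: measurable_shift.
move=> mf _ [[a b]] _ <-.
rewrite /pushforward shift_preimage/= !lebesgue_measure_itv/=.
rewrite !lte_fin ltrD2r -!EFinD; case: ifP => // _; congr EFin.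
by rewrite opprB addrA subrK.
Qed.

Lemma integ_shift h g : integ setT g ->
  integ setT (fun s => g (s + h)) /\ \int[mu]_s g (s + h) = \int[mu]_s g s.
Proof.
move=> gi; have mg := integ_meas gi.
have mE : measurable_fun setT (EFin \o g) by exact/measurable_EFinP.
have gi' : integ setT (fun s => g (s + h)).
  apply/integrableP; split.
    by apply/measurable_EFinP; apply: (measurableT_comp mg (measurable_shift h)).
  have mA : measurable_fun setT (fun y => `|(EFin \o g) y|%E) by exact: measurableT_comp.
  have := ge0_integral_pushforward (measurable_shift h) mu measurableT mA
    (fun y _ => abse_ge0 _).
  rewrite preimage_setT => <-.
  move/integrableP : gi => [_]; apply: le_lt_trans.
  rewrite le_eqVlt; apply/orP; left; apply/eqP.
  by apply: eq_measure_integral => [|mf B mB _]; [exact: measurable_shift|exact: lebesgue_shift].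
split => //.
have := @integral_pushforward _ _ _ _ R _ (measurable_shift h) mu setT (EFin \o g) mE.
rewrite preimage_setT => /(_ gi' measurableT) E.
rewrite /Rintegral -E; congr fine.
by apply: eq_measure_integral => [|mf B mB _]; [exact: measurable_shift|exact: lebesgue_shift].
Qed.

Lemma integ_shift_itv h a c f : integ `[a, c] f ->
  integ `[a - h, c - h] (fun s => f (s + h)).
Proof.
move=> fi; have fi' : integ setT (f \_ `[a, c]) by apply: (integ_restrict f _).1.
have [+ _] := integ_shift h fi'.
have -> : (fun s => (f \_ `[a, c]) (s + h)) = (fun s => f (s + h)) \_ `[a - h, c - h].
  apply/funext => s; rewrite !patchE !mem_setE !in_itv/=.
  by rewrite lerBlDr lerBrDr.
by move=> ?; apply: (integ_restrict _ _).2.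
Qed.

Lemma Rintegral_shift h a c f : integ `[a, c] f ->
  \int[mu]_(s in `[a - h, c - h]) f (s + h) = \int[mu]_(s in `[a, c]) f s.
Proof.
move=> fi; have fi' : integ setT (f \_ `[a, c]) by apply: (integ_restrict f _).1.
have [_ E] := integ_shift h fi'; rewrite [RHS]Rintegral_mkcond -E.
rewrite Rintegral_mkcond; apply: eq_Rintegral => s _.
by rewrite !patchE !mem_setE !in_itv/= lerBlDr lerBrDr.
Qed.

Lemma L2_shift h a c f : L2_real a c f -> L2_real (a - h) (c - h) (fun s => f (s + h)).
Proof.
move=> f2; have [_ fi] := (L2_realP _ _ _).1 f2.
apply/L2_realP; split.
  have /integ_meas := integ_shift_itv h (L2_integ f2).
  by apply: measurable_funS => //; exact: subset_itv_oo_cc.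
apply/integ_oo_cc; apply: (@integ_shift_itv h a c (fun t => f t ^+ 2)).
by apply/integ_oo_cc.
Qed.

End Translation.

(** * The complex Volterra operator *)

Section Volterra.
Context {R : realType}.
Local Open Scope classical_set_scope.
Local Open Scope ring_scope.
Local Notation C := R[i].
Local Notation mu := (@lebesgue_measure R).
Local Notation integ D f := (mu.-integrable D (EFin \o f)).
Local Notation Re := complex.Re.
Local Notation Im := complex.Im.
Implicit Types (a b c t s e x : R) (u v w p : R -> C).

(** Equivalent to the modulus, but with values in R rather than in R[i]. *)
Definition norm1 (z : C) : R := `|Re z| + `|Im z|.

Lemma norm1_ge0 z : 0 <= norm1 z. Proof. exact: addr_ge0. Qed.

Lemma ReD (y z : C) : Re (y + z) = Re y + Re z. Proof. by case: y; case: z. Qed.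
Lemma ImD (y z : C) : Im (y + z) = Im y + Im z. Proof. by case: y; case: z. Qed.
Lemma ReN (y : C) : Re (- y) = - Re y. Proof. by case: y. Qed.
Lemma ImN (y : C) : Im (- y) = - Im y. Proof. by case: y. Qed.
Lemma ReB (y z : C) : Re (y - z) = Re y - Re z. Proof. by case: y; case: z. Qed.
Lemma ImB (y z : C) : Im (y - z) = Im y - Im z. Proof. by case: y; case: z. Qed.
Lemma ReM (y z : C) : Re (y * z) = Re y * Re z - Im y * Im z.
Proof. by case: y; case: z. Qed.
Lemma ImM (y z : C) : Im (y * z) = Re y * Im z + Im y * Re z.
Proof. by case: y; case: z. Qed.
Lemma ReImP (y z : C) : Re y = Re z -> Im y = Im z -> y = z.
Proof. by case: y => ? ?; case: z => ? ? /= -> ->. Qed.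

Lemma norm1_eq0 z : norm1 z = 0 -> z = 0.
Proof.
move=> /eqP; rewrite /norm1 paddr_eq0// !normr_eq0 => /andP[/eqP h1 /eqP h2].
exact: ReImP.
Qed.

Lemma norm1D y z : norm1 (y + z) <= norm1 y + norm1 z.
Proof. by rewrite /norm1 ReD ImD addrACA lerD// ler_normD. Qed.

Lemma norm1N y : norm1 (- y) = norm1 y.
Proof. by rewrite /norm1 ReN ImN !normrN. Qed.

Lemma norm1M y z : norm1 (y * z) <= norm1 y * norm1 z.
Proof.
rewrite /norm1 ReM ImM.
have h1 := ler_normB (Re y * Re z) (Im y * Im z).
have h2 := ler_normD (Re y * Im z) (Im y * Re z).
rewrite !normrM in h1 h2.
by apply: (le_trans (lerD h1 h2)); rewrite le_eqVlt; apply/orP; left; apply/eqP; ring.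
Qed.

Lemma Re_le_norm1 z : `|Re z| <= norm1 z. Proof. by rewrite lerDl. Qed.
Lemma Im_le_norm1 z : `|Im z| <= norm1 z. Proof. by rewrite lerDr. Qed.

(** The operator that inverts the second derivative under zero Cauchy data at a. *)
Definition volterra a w t : C :=
  Complex (\int[mu]_(s in `[a, t]) ((t - s) * re w s))
          (\int[mu]_(s in `[a, t]) ((t - s) * im w s)).

Definition cinteg a c w := integ `[a, c] (re w) /\ integ `[a, c] (im w).

(** A class stable under uniform limits, and large enough for the products with
    an integrable coefficient to be integrable. *)
Definition cbounded a c u := [/\ measurable_fun `[a, c] (re u),
  measurable_fun `[a, c] (im u) &
  exists M, forall t, t \in `[a, c] -> norm1 (u t) <= M].

Lemma cinteg_norm1 a c p : cinteg a c p -> integ `[a, c] (fun t => norm1 (p t)).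
Proof.
by move=> [p1 p2]; apply: integD => //; exact: integrable_norm.
Qed.

Lemma cinteg_mul a c p u : cinteg a c p -> cbounded a c u ->
  cinteg a c (fun t => p t * u t).
Proof.
move=> [p1 p2] [u1 u2 [M uM]].
have b1 t : t \in `[a, c] -> `|re u t| <= M.
  by move=> /uM; exact: le_trans (Re_le_norm1 _).
have b2 t : t \in `[a, c] -> `|im u t| <= M.
  by move=> /uM; exact: le_trans (Im_le_norm1 _).
split.
- rewrite (_ : re _ = fun t => re p t * re u t - im p t * im u t).
    by apply: integB => //; exact: (@integ_mul_bounded _ _ _ _ M).
  by apply/funext => t; rewrite /re ReM.
- rewrite (_ : im _ = fun t => re p t * im u t + im p t * re u t).
    by apply: integD => //; exact: (@integ_mul_bounded _ _ _ _ M).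
  by apply/funext => t; rewrite /im ImM.
Qed.

Lemma integ_kernel a c t (f : R -> R) : t <= c -> integ `[a, c] f ->
  integ `[a, t] (fun s => (t - s) * f s).
Proof.
move=> tc fi; rewrite (_ : (fun s => _) = fun s => f s * (t - s)); last first.
  by apply/funext => s; rewrite mulrC.
apply: (@integ_mul_bounded _ _ _ _ (t - a)) => //.
- by apply: integ_subitv fi.
- exact: measurable_funB.
- move=> s /=; rewrite in_itv/= => /andP[as_ st].
  by rewrite ger0_norm ?subr_ge0// lerD2l lerN2.
Qed.

Lemma volterraB a c v w t : t <= c -> cinteg a c v -> cinteg a c w ->
  volterra a v t - volterra a w t = volterra a (fun s => v s - w s) t.
Proof.
move=> tc [v1 v2] [w1 w2]; apply: ReImP; rewrite ?(ReD, ImD, ReN, ImN)/=.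
- rewrite -RintegralB//; [|exact: integ_kernel tc _..].
  by apply: eq_Rintegral => s _; rewrite /re ReD ReN mulrBr.
- rewrite -RintegralB//; [|exact: integ_kernel tc _..].
  by apply: eq_Rintegral => s _; rewrite /im ImD ImN mulrBr.
Qed.

Lemma eq_volterra a v w t : {in `[a, t], v =1 w} -> volterra a v t = volterra a w t.
Proof.
move=> vw; rewrite /volterra; congr Complex.
  by apply: eq_Rintegral => s; rewrite inE/= => sat; rewrite /re vw.
by apply: eq_Rintegral => s; rewrite inE/= => sat; rewrite /im vw.
Qed.

Lemma volterra_bounded a c w : cinteg a c w -> cbounded a c (volterra a w).
Proof.
move=> [w1 w2]; have h1 := remainder_continuous w1; have h2 := remainder_continuous w2.
split; [exact: cont_meas h1|exact: cont_meas h2|].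
have [M1 _ k1] := cont_bounded h1; have [M2 _ k2] := cont_bounded h2.
by exists (M1 + M2) => t tac; rewrite lerD// ?k1 ?k2.
Qed.

Lemma cboundedD a c u v : cbounded a c u -> cbounded a c v ->
  cbounded a c (fun t => u t + v t).
Proof.
move=> [u1 u2 [M uM]] [v1 v2 [M' vM]]; split.
- rewrite (_ : re _ = fun t => re u t + re v t); first exact: measurable_funD.
  by apply/funext => t; rewrite /re ReD.
- rewrite (_ : im _ = fun t => im u t + im v t); first exact: measurable_funD.
  by apply/funext => t; rewrite /im ImD.
- by exists (M + M') => t tac; rewrite (le_trans (norm1D _ _))// lerD ?uM ?vM.
Qed.

Lemma cboundedN a c u : cbounded a c u -> cbounded a c (fun t => - u t).
Proof.
move=> [u1 u2 [M uM]]; split.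
- rewrite (_ : re _ = fun t => - re u t); last by apply/funext => t; rewrite /re ReN.
  exact: measurableT_comp.
- rewrite (_ : im _ = fun t => - im u t); last by apply/funext => t; rewrite /im ImN.
  exact: measurableT_comp.
- by exists M => t tac; rewrite norm1N uM.
Qed.

(** Relative to the weight e^(K (t - a)) the kernel is (t - s) e^(- K (t - s)),
    which is at most 1 / K because x <= e^x. *)
Lemma weighted_kernel_bound a t (f g : R -> R) M K L : 0 < K -> 0 <= M -> (forall s, 0 <= g s) ->
  integ `[a, t] f -> integ `[a, t] g -> \int[mu]_(s in `[a, t]) g s <= L ->
  (forall s, s \in `[a, t] -> `|f s| <= g s * (M * expR (K * (s - a)))) ->
  `|\int[mu]_(s in `[a, t]) ((t - s) * f s)| <= M * L / K * expR (K * (t - a)).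
Proof.
move=> K0 M0 g0 fi gi gL fg.
have w0 : 0 <= M / K * expR (K * (t - a)) by rewrite !mulr_ge0// ?expR_ge0// ltW// invr_gt0.
apply: (@le_trans _ _ (\int[mu]_(s in `[a, t]) (M / K * expR (K * (t - a)) * g s))).
  apply: norm_Rintegral_le => //; [exact: integ_kernel fi|exact: integZ|].
  move=> s /[dup] st' /=; rewrite in_itv/= => /andP[as_ st].
  have := fg s; rewrite in_itv/= as_ st => /(_ isT) fs.
  rewrite normrM ger0_norm ?subr_ge0//.
  have -> : K * (t - a) = K * (s - a) + K * (t - s) by ring.
  rewrite expRD.
  have e1 := expR_ge1Dx (K * (t - s)).
  apply: (le_trans (ler_wpM2l _ fs)); first by rewrite subr_ge0.
  rewrite -subr_ge0.
  have -> : M / K * (expR (K * (s - a)) * expR (K * (t - s))) * g s -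
    (t - s) * (g s * (M * expR (K * (s - a)))) =
    (M / K * g s * expR (K * (s - a))) * (expR (K * (t - s)) - K * (t - s)).
    by field; rewrite gt_eqF.
  rewrite mulr_ge0//; last by lra.
  by rewrite !mulr_ge0 ?expR_ge0// ltW// invr_gt0.
rewrite RintegralZl// (_ : M * L / K * _ = M / K * expR (K * (t - a)) * L); last by ring.
exact: ler_wpM2l.
Qed.

Lemma geometric_le0 (x D : R) : (forall n, x <= D * 2^-1 ^+ n) -> x <= 0.
Proof.
move=> h.
have : (fun n => D * 2^-1 ^+ n) @ \oo --> D * (0 : R).
  apply: cvgM; first exact: cvg_cst.
  by apply: cvg_expr; rewrite ger0_norm// invf_lt1// ltr1n.
by rewrite mulr0 => /cvgr_to_ge; apply; exact: nearW.
Qed.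

(** The limit is the supremum of the nondecreasing sequence x n - 2 D / 2^n,
    every term of which lies below every x n + 2 D / 2^n. *)
Lemma geometric_cauchy (x : nat -> R) D :
  (forall n, `|x n.+1 - x n| <= D * 2^-1 ^+ n) ->
  exists l, forall n, `|l - x n| <= 2 * D * 2^-1 ^+ n.
Proof.
move=> h; have D0 : 0 <= D by have := h 0; rewrite expr0 mulr1; exact: le_trans.
pose d n := 2 * D * 2^-1 ^+ n : R.
have d0 n : 0 <= d n by rewrite !mulr_ge0// exprn_ge0.
have dS n : d n.+1 = d n - D * 2^-1 ^+ n by rewrite /d exprS; field.
have inc : {homo (fun n => x n - d n) : m n / (m <= n)%N >-> m <= n}.
  apply: homo_leq => [//|y z w|n]; first exact: le_trans.
  by have := h n; rewrite ler_norml dS => /andP[]; lra.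
have dec : {homo (fun n => - (x n + d n)) : m n / (m <= n)%N >-> m <= n}.
  apply: homo_leq => [//|y z w|n]; first exact: le_trans.
  by have := h n; rewrite ler_norml dS => /andP[]; lra.
have cross m n : x m - d m <= x n + d n.
  have i1 := inc _ _ (leq_maxl m n); have i2 := dec _ _ (leq_maxr m n).
  have := d0 (maxn m n); lra.
have ne : range (fun n => x n - d n) !=set0 by exists (x 0 - d 0); exists 0.
have ub : has_sup (range (fun n => x n - d n)).
  by split => //; exists (x 0 + d 0) => _ [m _ <-]; exact: cross.
exists (sup (range (fun n => x n - d n))) => n.
have s1 : x n - d n <= sup (range (fun n => x n - d n)).
  by apply: sup_upper_bound => //; exists n.
have s2 : sup (range (fun n => x n - d n)) <= x n + d n.
  by apply: sup_le_ub => // _ [m _ <-]; exact: cross.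
by rewrite ler_norml -/(d n); apply/andP; split; lra.
Qed.

End Volterra.

(** * Picard iteration in a weighted norm *)

Section Picard.
Context {R : realType}.
Local Open Scope classical_set_scope.
Local Open Scope ring_scope.
Local Notation C := R[i].
Local Notation mu := (@lebesgue_measure R).
Local Notation integ D f := (mu.-integrable D (EFin \o f)).
Local Notation Re := complex.Re.
Local Notation Im := complex.Im.
Implicit Types (a b c t s e x : R) (u v w p : R -> C).

(** With L the integral of |p|, each of the two real components contributes at
    most M L / K, and K >= 4 L leaves 1 / 2. Since K depends on p alone, the
    segment need not be cut into short pieces. *)
Lemma volterra_halves a c p u M K :
  K = 4 * (\int[mu]_(s in `[a, c]) norm1 (p s)) + 1 ->
  0 <= M -> cinteg a c p -> cbounded a c u ->
  (forall t, t \in `[a, c] -> norm1 (u t) <= M * expR (K * (t - a))) ->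
  forall t, t \in `[a, c] ->
    norm1 (volterra a (fun s => p s * u s) t) <= M / 2 * expR (K * (t - a)).
Proof.
set L := \int[mu]_(_ in _) _ => KE M0 pi ub uM t /[dup] tac; rewrite in_itv/= => /andP[at_ tc].
have L0 : 0 <= L by apply: Rintegral_ge0 => s _; exact: norm1_ge0.
have K0 : 0 < K by rewrite KE; lra.
have [pu1 pu2] := cinteg_mul pi ub.
have ni := cinteg_norm1 pi.
have nL : \int[mu]_(s in `[a, t]) norm1 (p s) <= L.
  rewrite /L (Rintegral_itv_split at_ tc)// lerDl; apply: Rintegral_ge0 => s _; exact: norm1_ge0.
have e s : s \in `[a, t] -> norm1 (p s * u s) <= norm1 (p s) * (M * expR (K * (s - a))).
  rewrite in_itv/= => /andP[as_ st]; apply: (le_trans (norm1M _ _)).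
  apply: ler_wpM2l; first exact: norm1_ge0.
  by apply: uM; rewrite in_itv/= as_ (le_trans st).
have sub f : integ `[a, c] f -> integ `[a, t] f by exact: integ_subitv.
have b1 := weighted_kernel_bound K0 M0 (fun s => norm1_ge0 (p s)) (sub _ pu1) (sub _ ni) nL
  (fun s h => le_trans (Re_le_norm1 _) (e s h)).
have b2 := weighted_kernel_bound K0 M0 (fun s => norm1_ge0 (p s)) (sub _ pu2) (sub _ ni) nL
  (fun s h => le_trans (Im_le_norm1 _) (e s h)).
apply: (le_trans (lerD b1 b2)); rewrite -mulrDl ler_wpM2r ?expR_ge0//.
rewrite -mulrDl ler_pdivrMr// KE; nra.
Qed.

(** Iterating [volterra_halves] bounds u by M 2^-n e^(K (t - a)) for all n. *)
Lemma volterra_unique a c p u : cinteg a c p -> cbounded a c u ->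
  (forall t, t \in `[a, c] -> u t = volterra a (fun s => p s * u s) t) ->
  forall t, t \in `[a, c] -> u t = 0.
Proof.
move=> pi ub uE; have [_ _ [M uM]] := ub.
pose K := 4 * (\int[mu]_(s in `[a, c]) norm1 (p s)) + 1.
have L0 : 0 <= \int[mu]_(s in `[a, c]) norm1 (p s).
  by apply: Rintegral_ge0 => s _; exact: norm1_ge0.
have H n t : t \in `[a, c] -> norm1 (u t) <= `|M| * 2^-1 ^+ n * expR (K * (t - a)).
  elim: n t => [|n IH] t tac.
    rewrite expr0 mulr1 (le_trans (uM t tac))// (le_trans (ler_norm _))//.
    rewrite ler_peMr// (le_trans _ (expR_ge1Dx _))// lerDl mulr_ge0//.
      by rewrite addr_ge0// mulr_ge0.
    by rewrite subr_ge0; move: tac; rewrite in_itv/= => /andP[].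
  rewrite uE// exprS mulrA mulrAC -mulrA mulrC mulrA.
  rewrite (_ : _ * _ * _ = `|M| * 2^-1 ^+ n / 2 * expR (K * (t - a))); last by field.
  by apply: volterra_halves tac => //; rewrite mulr_ge0// exprn_ge0.
move=> t tac; apply: norm1_eq0; apply/eqP; rewrite eq_le norm1_ge0 andbT.
apply: (@geometric_le0 _ _ (`|M| * expR (K * (t - a)))) => n.
by rewrite mulrAC; exact: H.
Qed.

(** Picard iteration from 0. Successive iterates differ by a multiple of 2^-n,
    so they converge uniformly, and the contraction estimate passes to the
    limit. *)
Lemma volterra_exists a c p f : cinteg a c p -> cbounded a c f ->
  exists2 u, cbounded a c u &
    forall t, t \in `[a, c] -> u t = f t + volterra a (fun s => p s * u s) t.
Proof.
move=> pi fb.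
pose K := 4 * (\int[mu]_(s in `[a, c]) norm1 (p s)) + 1.
have L0 : 0 <= \int[mu]_(s in `[a, c]) norm1 (p s).
  by apply: Rintegral_ge0 => s _; exact: norm1_ge0.
have K0 : 0 <= K by rewrite addr_ge0// mulr_ge0.
have e1 t : t \in `[a, c] -> 1 <= expR (K * (t - a)) <= expR (K * (c - a)).
  rewrite in_itv/= => /andP[at_ tc]; apply/andP; split.
    by rewrite (le_trans _ (expR_ge1Dx _))// lerDl mulr_ge0// subr_ge0.
  by rewrite ler_expR ler_wpM2l// lerD2r.
pose T u t := f t + volterra a (fun s => p s * u s) t.
have Tb u : cbounded a c u -> cbounded a c (T u).
  by move=> ub; apply: cboundedD => //; apply: volterra_bounded; exact: cinteg_mul.
have T_contr u v M : 0 <= M -> cbounded a c u -> cbounded a c v ->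
    (forall t, t \in `[a, c] -> norm1 (u t - v t) <= M * expR (K * (t - a))) ->
    forall t, t \in `[a, c] -> norm1 (T u t - T v t) <= M / 2 * expR (K * (t - a)).
  move=> M0 ub vb uv t tac; rewrite /T opprD addrACA subrr add0r.
  move: (tac); rewrite in_itv/= => /andP[_ tc].
  rewrite (volterraB tc); [|exact: cinteg_mul..].
  rewrite (@eq_volterra _ _ _ (fun s => p s * (u s - v s))).
    apply: volterra_halves tac => //.
    by apply: cboundedD => //; exact: cboundedN.
  by move=> s _; rewrite mulrBr.
pose U n := iter n T (fun=> 0).
have Ub n : cbounded a c (U n).
  elim: n => [|n IH]; last exact: Tb.
  split; [exact: measurable_cst|exact: measurable_cst|].
  by exists 0 => t _; rewrite /norm1/= !normr0 addr0.
have [_ _ [M0 UM]] := Ub 1%N.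
pose M : R := `|M0|; have M_ge0 : 0 <= M by exact: normr_ge0.
have Ud n t : t \in `[a, c] ->
    norm1 (U n.+1 t - U n t) <= M * 2^-1 ^+ n * expR (K * (t - a)).
  elim: n t => [|n IH] t tac.
    rewrite expr0 mulr1 {2}/U/= subr0 (le_trans (UM t tac))// (le_trans (ler_norm _))//.
    by rewrite ler_peMr//; have /andP[] := e1 t tac.
  rewrite exprSr mulrA; apply: (T_contr (U n.+1) (U n) _ _ (Ub n.+1) (Ub n) IH) => //.
  by apply: mulr_ge0 => //; exact: exprn_ge0.
pose D : R := M * expR (K * (c - a)).
have D0 : 0 <= D by rewrite mulr_ge0// expR_ge0.
have Ud' n t : t \in `[a, c] -> norm1 (U n.+1 t - U n t) <= D * 2^-1 ^+ n.
  move=> tac; apply: (le_trans (Ud n t tac)); rewrite /D mulrAC.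
  rewrite ler_wpM2r ?exprn_ge0// ler_wpM2l//.
  by have /andP[] := e1 t tac.
have lim t : exists l, t \in `[a, c] -> forall n, norm1 (l - U n t) <= 4 * D * 2^-1 ^+ n.
  have [tac|] := boolP (t \in `[a, c]); last by exists 0.
  have [|l1 h1] := @geometric_cauchy _ (fun n => Re (U n t)) D.
    move=> n; apply: le_trans (Ud' n t tac); apply: le_trans (Re_le_norm1 _).
    by rewrite -ReB.
  have [|l2 h2] := @geometric_cauchy _ (fun n => Im (U n t)) D.
    move=> n; apply: le_trans (Ud' n t tac); apply: le_trans (Im_le_norm1 _).
    by rewrite -ImB.
  exists (Complex l1 l2) => _ n; rewrite /norm1 ReB ImB/=.
  apply: (le_trans (lerD (h1 n) (h2 n))); rewrite le_eqVlt; apply/orP; left; apply/eqP; ring.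
have [u uU] := choice lim.
have cvg0 : (fun n => 4 * D * 2^-1 ^+ n) @ \oo --> (0 : R).
  rewrite -(mulr0 (4 * D)); apply: cvgM; first exact: cvg_cst.
  by apply: cvg_expr; rewrite ger0_norm// invf_lt1// ltr1n.
have ub : cbounded a c u.
  split.
  - apply: (@measurable_fun_cvg _ _ _ _ (fun n => re (U n))).
      by move=> n; have [] := Ub n.
    move=> t tac; apply/cvgrPdist_le => e e0; near=> n.
    apply: (@le_trans _ _ (4 * D * 2^-1 ^+ n)).
      apply: le_trans (uU t tac n); apply: le_trans (Re_le_norm1 _).
      by rewrite -ReB.
    by near: n; apply: (cvgr_le _ cvg0).
  - apply: (@measurable_fun_cvg _ _ _ _ (fun n => im (U n))).
      by move=> n; have [] := Ub n.
    move=> t tac; apply/cvgrPdist_le => e e0; near=> n.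
    apply: (@le_trans _ _ (4 * D * 2^-1 ^+ n)).
      apply: le_trans (uU t tac n); apply: le_trans (Im_le_norm1 _).
      by rewrite -ImB.
    by near: n; apply: (cvgr_le _ cvg0).
  - exists (4 * D) => t tac; have := uU t tac 0%N.
    by rewrite expr0 mulr1 {1}/U/= subr0.
exists u => // t tac; apply/eqP; rewrite -subr_eq0; apply/eqP; apply: norm1_eq0.
apply/eqP; rewrite eq_le norm1_ge0 andbT.
apply: (@geometric_le0 _ _ (4 * D + 4 * D * expR (K * (t - a)))) => n.
have -> : u t - (f t + volterra a (fun s => p s * u s) t) =
    (u t - U n.+1 t) + (T (U n) t - T u t) by rewrite /T /U/= addrA subrK.
apply: (le_trans (norm1D _ _)).
have i1 := uU t tac n.+1.
have i2 : norm1 (T (U n) t - T u t) <= 4 * D * 2^-1 ^+ n / 2 * expR (K * (t - a)).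
  apply: T_contr => //.
    by rewrite !mulr_ge0// exprn_ge0.
  move=> s sac; rewrite -norm1N opprB (le_trans (uU s sac n))//.
  rewrite ler_peMr//; first by rewrite !mulr_ge0// exprn_ge0.
  by have /andP[] := e1 s sac.
apply: (le_trans (lerD i1 i2)); rewrite exprS.
have q0 : 0 <= 2^-1 ^+ n :> R by rewrite exprn_ge0.
have E0 := expR_ge0 (K * (t - a)).
move: (2^-1 ^+ n) (expR _) (mulr_ge0 D0 q0) (mulr_ge0 (mulr_ge0 D0 q0) E0) => q E {}q0 {}E0.
rewrite -subr_ge0 (_ : _ - _ = 2 * (D * q) + 2 * (D * q * E)); last by field.
by rewrite addr_ge0// mulr_ge0.
Unshelve. all: by end_near. Qed.

End Picard.

(** * Weak solutions in Volterra form *)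

Section Solutions.
Context {R : realType}.
Local Open Scope classical_set_scope.
Local Open Scope ring_scope.
Local Notation C := R[i].
Local Notation mu := (@lebesgue_measure R).
Local Notation integ D f := (mu.-integrable D (EFin \o f)).
Local Notation Re := complex.Re.
Local Notation Im := complex.Im.
Implicit Types (a b c d t s e x : R) (u v w p q : R -> C) (A S lambda : C).

Definition cint a t w : C :=
  Complex (\int[mu]_(s in `[a, t]) re w s) (\int[mu]_(s in `[a, t]) im w s).

Definition ccont a c u := {within `[a, c], continuous (re u)} /\
  {within `[a, c], continuous (im u)}.

(** Value A and right slope S at a, second derivative w; for w = (q - lambda) u
    this is the integral form of the Schrodinger equation. *)
Definition volterra_form a c w A S u := forall t, t \in `[a, c] ->
  u t = A + S * (t - a)%:C%C + volterra a w t.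

Lemma volterra_form_re a c w A S u : volterra_form a c w A S u ->
  taylor_form a c (re w) (Re A) (Re S) (re u).
Proof. by move=> h t /h; rewrite /re => ->; rewrite !ReD ReM/= mulr0 subr0. Qed.

Lemma volterra_form_im a c w A S u : volterra_form a c w A S u ->
  taylor_form a c (im w) (Im A) (Im S) (im u).
Proof. by move=> h t /h; rewrite /im => ->; rewrite !ImD ImM/= mulr0 add0r. Qed.

Lemma L2_cinteg a c w : L2 a c w -> cinteg a c w.
Proof. by move=> [w1 w2]; split; exact: L2_integ. Qed.

Lemma cint_meas a c w : cinteg a c w ->
  measurable_fun `[a, c] (re w) /\ measurable_fun `[a, c] (im w).
Proof. by move=> [w1 w2]; split; exact: integ_meas. Qed.

Lemma ccont_bounded a c u : ccont a c u -> cbounded a c u.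
Proof.
move=> [c1 c2]; split; [exact: cont_meas|exact: cont_meas|].
have [M1 _ k1] := cont_bounded c1; have [M2 _ k2] := cont_bounded c2.
by exists (M1 + M2) => t tac; rewrite lerD// ?k1 ?k2.
Qed.

Lemma cboundedB a c u v : cbounded a c u -> cbounded a c v ->
  cbounded a c (fun t => u t - v t).
Proof. by move=> ub vb; apply: cboundedD => //; exact: cboundedN. Qed.

Lemma L2_mul a c p u : L2 a c p -> cbounded a c u -> L2 a c (fun t => p t * u t).
Proof.
move=> [p1 p2] [u1 u2 [M uM]].
have oo : `]a, c[ `<=` `[a, c] by exact: subset_itv_oo_cc.
have m1 : measurable_fun `]a, c[ (re u) by exact: measurable_funS u1.
have m2 : measurable_fun `]a, c[ (im u) by exact: measurable_funS u2.
have b1 t : t \in `]a, c[ -> `|re u t| <= M.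
  by move=> /subset_itv_oo_cc/uM; exact: le_trans (Re_le_norm1 _).
have b2 t : t \in `]a, c[ -> `|im u t| <= M.
  by move=> /subset_itv_oo_cc/uM; exact: le_trans (Im_le_norm1 _).
split.
- rewrite (_ : re _ = fun t => re p t * re u t + (-1) * (im p t * im u t)).
    by apply: L2_add; [|apply: L2_scale]; exact: L2_mul_bounded b1 || exact: L2_mul_bounded b2.
  by apply/funext => t; rewrite /re ReM mulN1r.
- rewrite (_ : im _ = fun t => re p t * im u t + im p t * re u t).
    by apply: L2_add; exact: L2_mul_bounded b1 || exact: L2_mul_bounded b2.
  by apply/funext => t; rewrite /im ImM.
Qed.

Lemma L2_sub_cst a c q lambda : L2 a c q -> L2 a c (fun t => q t - lambda).
Proof.
move=> [q1 q2]; split.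
- rewrite (_ : re _ = fun t => re q t + - Re lambda).
    by apply: L2_add => //; exact: L2_cst.
  by apply/funext => t; rewrite /re ReB.
- rewrite (_ : im _ = fun t => im q t + - Im lambda).
    by apply: L2_add => //; exact: L2_cst.
  by apply/funext => t; rewrite /im ImB.
Qed.

Lemma L2_subinterval a b c d u : a <= c -> d <= b -> L2 a b u -> L2 c d u.
Proof. by move=> ac db [u1 u2]; split; [exact: L2_subitv u1|exact: L2_subitv u2]. Qed.

Lemma AC_ccont a b u : Defs.AC a b u -> ccont a b u.
Proof. by move=> [h1 h2]; split; exact: AC_continuous. Qed.

Lemma ccont_subinterval a b c d u : a <= c -> d <= b -> ccont a b u -> ccont c d u.
Proof.
move=> ac db [h1 h2]; have sub : `[c, d] `<=` `[a, b].
  by apply: subset_itv; rewrite bnd_simp.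
by split; [exact: continuous_subspaceW h1|exact: continuous_subspaceW h2].
Qed.

(** The weak second derivative is almost everywhere (q - lambda) u, which may
    replace it under the integral. *)
Lemma schrodinger_volterra a c q lambda u : a < c -> L2 a c q -> ccont a c u ->
  schrodinger_ae a c q lambda u ->
  exists S, volterra_form a c (fun t => (q t - lambda) * u t) (u a) S u.
Proof.
move=> ac q2 cu [v [w [[uv1 uv2] [vw1 vw2] eqn]]]; have [c1 c2] := cu.
have [S1 h1] := weak_taylor ac c1 uv1 vw1; have [S2 h2] := weak_taylor ac c2 uv2 vw2.
have pu2 := L2_mul (L2_sub_cst lambda q2) (ccont_bounded cu).
have [m1 m2] := cint_meas (L2_cinteg pu2).
have [_ w1 _] := vw1; have [_ w2 _] := vw2.
have mw1 := integ_meas (L2_integ w1); have mw2 := integ_meas (L2_integ w2).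
have eqn' : {ae mu, forall t, t \in `]a, c[ -> w t = (q t - lambda) * u t}.
  apply: filterS eqn; first exact: (ae_filter_ringOfSetsType mu).
  by move=> t h tac; rewrite mulrBl -h//; ring.
exists (Complex S1 S2) => t tac.
move: (tac); rewrite in_itv/= => /andP[at_ tc].
have sub : `[a, t] `<=` `[a, c] by apply: subset_itvl; rewrite bnd_simp.
have subo s : s \in `]a, t[ -> s \in `]a, c[.
  by rewrite !in_itv/= => /andP[-> st]; exact: lt_le_trans tc.
have M (f : R -> R) : measurable_fun `[a, c] f -> measurable_fun `[a, t] (fun s => (t - s) * f s).
  move=> mf; apply: measurable_funM; last exact: measurable_funS mf.
  exact: measurable_funB.
apply: ReImP; rewrite ?(ReD, ImD, ReM, ImM)/= mulr0 ?subr0 ?add0r.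
- rewrite -/(re u t) h1//; congr (_ + _); apply: ae_eq_Rintegral; [exact: M|exact: M|].
  apply: filterS eqn'; first exact: (ae_filter_ringOfSetsType mu).
  by move=> s h /subo/h E; rewrite /re E.
- rewrite -/(im u t) h2//; congr (_ + _); apply: ae_eq_Rintegral; [exact: M|exact: M|].
  apply: filterS eqn'; first exact: (ae_filter_ringOfSetsType mu).
  by move=> s h /subo/h E; rewrite /im E.
Qed.

Lemma volterra_form_unique a c p A S u v : cinteg a c p -> ccont a c u -> ccont a c v ->
  volterra_form a c (fun t => p t * u t) A S u ->
  volterra_form a c (fun t => p t * v t) A S v ->
  {in `[a, c], u =1 v}.
Proof.
move=> pi /ccont_bounded ub /ccont_bounded vb hu hv t tac; apply/eqP; rewrite -subr_eq0.
apply/eqP; move: t tac; apply: (volterra_unique pi (cboundedB ub vb)) => t tac.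
rewrite hu// hv// opprD addrACA subrr add0r.
move: (tac); rewrite in_itv/= => /andP[at_ tc].
rewrite (volterraB tc); [|exact: cinteg_mul..].
by apply: eq_volterra => s _; rewrite mulrBr.
Qed.

Lemma volterra_form_weak a c w A S u : L2 a c w -> volterra_form a c w A S u ->
  let v t := S + cint a t w in weak_derivative a c u v /\ weak_derivative a c v w.
Proof.
move=> [w1 w2] h v.
have [r1 r2] := taylor_weak w1 (volterra_form_re h).
have [i1 i2] := taylor_weak w2 (volterra_form_im h).
have vr : re v = fun t => Re S + \int[mu]_(s in `[a, t]) re w s.
  by apply/funext => t; rewrite /re /v ReD.
have vi : im v = fun t => Im S + \int[mu]_(s in `[a, t]) im w s.
  by apply/funext => t; rewrite /im /v ImD.
by rewrite /weak_derivative vr vi.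
Qed.

Lemma volterra_form_right a c w A S u : a < c -> cinteg a c w ->
  volterra_form a c w A S u -> derivative_right u a S.
Proof.
move=> ac [w1 w2] h; split.
  exact: (taylor_right ac w1 (volterra_form_re h)).
exact: (taylor_right ac w2 (volterra_form_im h)).
Qed.

Lemma volterra_form_left a c w A S u : a < c -> cinteg a c w ->
  volterra_form a c w A S u -> derivative_left u c (S + cint a c w).
Proof.
move=> ac [w1 w2] h; split; rewrite ?ReD ?ImD.
  exact: (taylor_left ac w1 (volterra_form_re h)).
exact: (taylor_left ac w2 (volterra_form_im h)).
Qed.

Lemma derivative_right_unique u a A S : derivative_right u a A ->
  derivative_right u a S -> A = S.
Proof.
move=> [h1 h2] [k1 k2]; apply: ReImP.
  by rewrite -(cvg_lim (@Rhausdorff R) h1) -(cvg_lim (@Rhausdorff R) k1).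
by rewrite -(cvg_lim (@Rhausdorff R) h2) -(cvg_lim (@Rhausdorff R) k2).
Qed.

Lemma derivative_left_unique u a A S : derivative_left u a A ->
  derivative_left u a S -> A = S.
Proof.
move=> [h1 h2] [k1 k2]; apply: ReImP.
  by rewrite -(cvg_lim (@Rhausdorff R) h1) -(cvg_lim (@Rhausdorff R) k1).
by rewrite -(cvg_lim (@Rhausdorff R) h2) -(cvg_lim (@Rhausdorff R) k2).
Qed.

Lemma derivative_left_eq a c u v S : a < c -> {in `[a, c], u =1 v} ->
  derivative_left u c S -> derivative_left v c S.
Proof.
move=> ac uv [h1 h2].
have uv1 : {in `]a, c[, re v =1 re u} by move=> t /subset_itv_oo_cc/uv; rewrite /re => ->.
have uv2 : {in `]a, c[, im v =1 im u} by move=> t /subset_itv_oo_cc/uv; rewrite /im => ->.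
split; [apply: cvg_trans h1|apply: cvg_trans h2]; apply: near_eq_cvg; near=> t.
  by apply/esym/(derive1_eq_in _ uv1); rewrite in_itv/=; apply/andP; split.
by apply/esym/(derive1_eq_in _ uv2); rewrite in_itv/=; apply/andP; split.
Unshelve. all: by end_near. Qed.

(** Moving the base point from a to d leaves behind the value and the slope
    reached at d. *)
Lemma volterra_restart a d t w : a <= d -> d <= t -> cinteg a t w ->
  volterra a w t = volterra a w d + cint a d w * (t - d)%:C%C + volterra d w t.
Proof.
move=> ad dt [w1 w2].
have E (f : R -> R) : integ `[a, t] f -> \int[mu]_(s in `[a, t]) ((t - s) * f s) =
   \int[mu]_(s in `[a, d]) ((d - s) * f s) + (\int[mu]_(s in `[a, d]) f s) * (t - d) +
   \int[mu]_(s in `[d, t]) ((t - s) * f s).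
  move=> fi; rewrite (Rintegral_itv_split ad dt); last exact: integ_kernel fi.
  have fi' : integ `[a, d] f by exact: integ_subitv fi.
  congr (_ + _); rewrite -RintegralZr// -RintegralD//; last 2 first.
  - exact: integ_kernel fi'.
  - have := integZ (t - d) (measurable_itv `[a, d]) fi'.
    by apply: eq_integrable => // s _ /=; rewrite mulrC.
  by apply: eq_Rintegral => s _; ring.
by apply: ReImP; rewrite ?(ReD, ImD, ReM, ImM)/= mulr0 ?subr0 ?add0r E.
Qed.

End Solutions.

(** * Jump conditions at the nodes *)

Section Interaction.
Context {R : realType}.
Local Open Scope classical_set_scope.
Local Open Scope ring_scope.
Local Notation C := R[i].
Local Notation mu := (@lebesgue_measure R).
Local Notation integ D f := (mu.-integrable D (EFin \o f)).
Local Notation Re := complex.Re.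
Local Notation Im := complex.Im.
Implicit Types (a b c d t s e : R) (u v w p q : R -> C) (A S lambda : C).

Lemma nodes_le N (x : nat -> R) : (forall k, (k <= N)%N -> x k < x k.+1) ->
  forall i j, (i <= j)%N -> (j <= N.+1)%N -> x i <= x j.
Proof.
move=> xi i j; elim: j => [|j IH]; first by rewrite leqn0 => /eqP->.
rewrite leq_eqVlt => /predU1P[->//|]; rewrite ltnS => ij jN.
by apply: (le_trans (IH ij (ltnW jN))); apply/ltW/xi.
Qed.

Lemma nodes_cover N (x : nat -> R) t : x 0%N <= t -> t <= x N.+1 ->
  exists2 k, (k <= N)%N & t \in `[x k, x k.+1].
Proof.
move=> t0; elim: N => [|N IH] tN; first by exists 0%N => //; rewrite in_itv/= t0.
have [tN'|tN'] := leP t (x N.+1).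
  by have [k kN tk] := IH tN'; exists k => //; rewrite (leq_trans kN).
by exists N.+1 => //; rewrite in_itv/= tN ltW.
Qed.

(** Value and right slope at a node determine a solution up to the next node,
    hence also its left slope there; the jump condition then gives the next
    right slope. *)
Lemma interaction_unique b q N (x : nat -> R) (alpha : nat -> C) lambda (u0 u1 : C) u v :
  L2 0 b q -> x 0%N = 0 -> x N.+1 = b -> (forall k, (k <= N)%N -> x k < x k.+1) ->
  interaction_cauchy b q N x alpha lambda u0 u1 u ->
  interaction_cauchy b q N x alpha lambda u0 u1 v -> {in `[0, b], u =1 v}.
Proof.
move=> q2 x0 xN xi [[[uAC _ uj] us] uu0 uu1] [[[vAC _ vj] vs] vu0 vu1].
have xle := nodes_le xi.
have x_ge0 k : (k <= N.+1)%N -> 0 <= x k by move=> kN; rewrite -x0; exact: xle.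
have x_leb k : (k <= N.+1)%N -> x k <= b by move=> kN; rewrite -xN; exact: xle.
have piece k S : (k <= N)%N -> u (x k) = v (x k) -> derivative_right u (x k) S ->
    derivative_right v (x k) S -> {in `[x k, x k.+1], u =1 v}.
  move=> kN uv uS vS; have xk := xi k kN.
  have k0 := x_ge0 k (leqW kN); have kb := x_leb k.+1 kN.
  have q2k := L2_subinterval k0 kb q2.
  have cu := ccont_subinterval k0 kb (AC_ccont uAC).
  have cv := ccont_subinterval k0 kb (AC_ccont vAC).
  have [S1 h1] := schrodinger_volterra xk q2k cu (us k kN).
  have [S2 h2] := schrodinger_volterra xk q2k cv (vs k kN).
  have p2 := L2_sub_cst lambda q2k.
  have r1 := volterra_form_right xk (L2_cinteg (L2_mul p2 (ccont_bounded cu))) h1.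
  have r2 := volterra_form_right xk (L2_cinteg (L2_mul p2 (ccont_bounded cv))) h2.
  rewrite (derivative_right_unique r1 uS) in h1.
  rewrite (derivative_right_unique r2 vS) -uv in h2.
  exact: (volterra_form_unique (L2_cinteg p2) cu cv h1 h2).
have step k : (k <= N)%N -> u (x k) = v (x k) /\
    exists S, derivative_right u (x k) S /\ derivative_right v (x k) S.
  elim: k => [_|k IH kN]; first by rewrite x0 uu0 vu0; split => //; exists u1.
  have [uv [S [uS vS]]] := IH (ltnW kN).
  have E := piece k S (ltnW kN) uv uS vS; have xk := xi k (ltnW kN).
  have uv' : u (x k.+1) = v (x k.+1) by apply: E; rewrite in_itv/= lexx ltW.
  split => //.
  have [l [r [ul ur lr]]] := uj k.+1 kN; have [l' [r' [vl vr lr']]] := vj k.+1 kN.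
  have ll' := derivative_left_unique (derivative_left_eq xk E ul) vl.
  have rr' : r = r' by rewrite -[r](subrK l) lr ll' uv' -lr' subrK.
  by exists r; split; [exact: ur|rewrite rr'; exact: vr].
move=> t; rewrite in_itv/= => /andP[t0 tb].
have [||k kN tk] := @nodes_cover N x t; rewrite ?x0 ?xN//.
have [uv [S [uS vS]]] := step k kN.
exact: (piece k S kN uv uS vS).
Qed.

Lemma pospart_lipschitz (s t : R) : s <= t -> `|pospart t - pospart s| <= t - s.
Proof.
move=> st; rewrite ger0_norm.
  by have [t0|t0] := leP 0 t; have [s0|s0] := leP 0 s;
    rewrite ?(pospart_id t0) ?(pospart_id s0) ?(pospart_eq0 (ltW t0)) ?(pospart_eq0 (ltW s0)); lra.
by have [t0|t0] := leP 0 t; have [s0|s0] := leP 0 s;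
    rewrite ?(pospart_id t0) ?(pospart_id s0) ?(pospart_eq0 (ltW t0)) ?(pospart_eq0 (ltW s0)); lra.
Qed.

Lemma Re_sum I (r : seq I) (P : pred I) (F : I -> C) :
  Re (\sum_(i <- r | P i) F i) = \sum_(i <- r | P i) Re (F i).
Proof. by apply: (big_ind2 (fun z y => Re z = y)) => // z y z' y' <- <-; exact: ReD. Qed.

Lemma Im_sum I (r : seq I) (P : pred I) (F : I -> C) :
  Im (\sum_(i <- r | P i) F i) = \sum_(i <- r | P i) Im (F i).
Proof. by apply: (big_ind2 (fun z y => Im z = y)) => // z y z' y' <- <-; exact: ImD. Qed.

Lemma kinked_AC b N (x : nat -> R) (beta : nat -> R) (f w : R -> R) (A S : R) :
  integ `[0, b] w ->
  (forall t, t \in `[0, b] -> f t = A + S * (t - 0) +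
     \sum_(1 <= k < N.+1) beta k * pospart (t - x k) +
     \int[mu]_(s in `[0, t]) ((t - s) * w s)) -> AC_real 0 b f.
Proof.
move=> wi fE.
pose g t := A + S * (t - 0) + \int[mu]_(s in `[0, t]) ((t - s) * w s).
have [M gM] := @taylor_lipschitz R 0 b g w A S wi (fun _ _ => erefl).
apply: (@lipschitz_AC _ _ _ _ (M + \sum_(1 <= k < N.+1) `|beta k|)) => s t s0 st tb.
have t0 := le_trans s0 st; have sb := le_trans st tb.
have -> : f t - f s = (g t - g s) +
    \sum_(1 <= k < N.+1) beta k * (pospart (t - x k) - pospart (s - x k)).
  rewrite !fE ?in_itv/= ?s0 ?sb ?t0 ?tb// /g.
  under [X in _ = _ + X]eq_bigr do rewrite mulrBr.
  by rewrite sumrB; ring.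
rewrite mulrDl (le_trans (ler_normD _ _))// lerD ?gM//.
rewrite (le_trans (ler_norm_sum _ _ _))// mulr_suml; apply: ler_sum => k _.
rewrite normrM ler_wpM2l// (le_trans (pospart_lipschitz _)) ?lerD2r//.
by rewrite opprB addrA subrK.
Qed.

(** On [x k, x k.+1] the kinks at x 1, ..., x k are affine and the later ones
    vanish, so that u is in Volterra form there. Passing x k adds beta k to
    the slope. *)
Lemma interaction_of_volterra b q N (x : nat -> R) (alpha beta : nat -> C) lambda (u0 u1 : C) u :
  L2 0 b q -> x 0%N = 0 -> x N.+1 = b -> (forall k, (k <= N)%N -> x k < x k.+1) ->
  cbounded 0 b u ->
  (forall t, t \in `[0, b] -> u t = u0 + u1 * (t - 0)%:C%C +
     \sum_(1 <= k < N.+1) beta k * (pospart (t - x k))%:C%C +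
     volterra 0 (fun s => (q s - lambda) * u s) t) ->
  (forall k, (1 <= k <= N)%N -> beta k = alpha k * u (x k)) ->
  interaction_cauchy b q N x alpha lambda u0 u1 u.
Proof.
move=> q2 x0 xN xi ub uE ba; pose w s := (q s - lambda) * u s.
have xle := nodes_le xi.
have x_ge0 k : (k <= N.+1)%N -> 0 <= x k by move=> kN; rewrite -x0; exact: xle.
have x_leb k : (k <= N.+1)%N -> x k <= b by move=> kN; rewrite -xN; exact: xle.
have w2 : L2 0 b w by exact: L2_mul (L2_sub_cst lambda q2) ub.
have [wi1 wi2] := L2_cinteg w2.
have b0 : 0 <= b by rewrite -xN x_ge0.
have uAC : Defs.AC 0 b u.
  split.
  - apply: (@kinked_AC b N x (fun k => Re (beta k)) _ _ (Re u0) (Re u1) wi1) => t tb.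
    rewrite {1}/re uE// !ReD Re_sum ReM/= mulr0 subr0; congr (_ + _ + _).
    by apply: eq_bigr => k _; rewrite ReM/= mulr0 subr0.
  - apply: (@kinked_AC b N x (fun k => Im (beta k)) _ _ (Im u0) (Im u1) wi2) => t tb.
    rewrite {1}/im uE// !ImD Im_sum ImM/= mulr0 add0r; congr (_ + _ + _).
    by apply: eq_bigr => k _; rewrite ImM/= mulr0 add0r.
(* S k is the right slope at x k: initial slope, jumps up to x k, and integral
   of the second derivative. *)
pose S k := u1 + \sum_(1 <= j < k.+1) beta j + cint 0 (x k) w.
have form k : (k <= N)%N -> volterra_form (x k) (x k.+1) w (u (x k)) (S k) u.
  move=> kN t; rewrite in_itv/= => /andP[kt tk].
  have k0 := x_ge0 k (leqW kN); have kb := x_leb k.+1 kN; have kk := ltW (xi k kN).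
  have split_sum s : x k <= s -> s <= x k.+1 ->
      \sum_(1 <= j < N.+1) beta j * (pospart (s - x j))%:C%C =
      \sum_(1 <= j < k.+1) beta j * (s - x j)%:C%C.
    move=> ks sk; rewrite (@big_cat_nat _ _ _ k.+1)//= [X in _ + X]big1_seq ?addr0; last first.
      move=> j; rewrite mem_index_iota => /andP[_ /andP[kj jN]].
      rewrite pospart_eq0 ?mulr0// subr_le0 (le_trans sk)//; apply: xle => //; exact: ltnW.
    apply: eq_big_nat => j /andP[_ jk]; rewrite pospart_id// subr_ge0 (le_trans _ ks)//.
    by apply: xle => //; exact: leqW.
  have tin : t \in `[0, b] by rewrite in_itv/= (le_trans k0 kt) (le_trans tk kb).
  have kin : x k \in `[0, b] by rewrite in_itv/= k0 (le_trans kk kb).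
  rewrite (uE t tin) (uE (x k) kin) !split_sum//.
  rewrite (volterra_restart k0 kt (w := w)); last first.
    by split; apply: integ_subitv wi1 || apply: integ_subitv wi2; rewrite // (le_trans tk kb).
  rewrite /S !subr0.
  have -> : \sum_(1 <= j < k.+1) beta j * (t - x j)%:C%C =
     \sum_(1 <= j < k.+1) beta j * (x k - x j)%:C%C +
     (\sum_(1 <= j < k.+1) beta j) * (t - x k)%:C%C.
    rewrite mulr_suml -big_split/=; apply: eq_bigr => j _.
    by rewrite -mulrDr -rmorphD/=; congr (_ * _%:C%C); ring.
  have -> : t%:C%C = (x k)%:C%C + (t - x k)%:C%C by rewrite -rmorphD/= addrC subrK.
  by rewrite -/w; ring.
have wk k : (k <= N)%N -> L2 (x k) (x k.+1) w.
  by move=> kN; apply: L2_subinterval w2; [exact/x_ge0/leqW|exact: x_leb].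
have weak k (kN : (k <= N)%N) := volterra_form_weak (wk k kN) (form k kN).
split; [split; [split|]| |].
- exact: uAC.
- by move=> k kN; have [h1 h2] := weak k kN; eexists; exists w; split; [exact: h1|exact: h2].
- move=> [//|k] /andP[_ kN].
  exists (S k + cint (x k) (x k.+1) w), (S k.+1); split.
  + exact: volterra_form_left (xi k (ltnW kN)) (L2_cinteg (wk k (ltnW kN))) (form k (ltnW kN)).
  + exact: volterra_form_right (xi k.+1 kN) (L2_cinteg (wk k.+1 kN)) (form k.+1 kN).
  + rewrite -ba// /S (@big_nat_recr _ _ _ k.+1)//=.
    have -> : cint 0 (x k.+1) w = cint 0 (x k) w + cint (x k) (x k.+1) w.
      have k0 := x_ge0 k (leqW (ltnW kN)); have kk := ltW (xi k (ltnW kN)).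
      have kb := x_leb k.+1 (ltnW kN).
      by apply: ReImP; rewrite ?ReD ?ImD/= (Rintegral_itv_split k0 kk)//; exact: integ_subitv kb _.
    by ring.
- move=> k kN; have [h1 h2] := weak k kN; eexists; exists w; split; [exact: h1|exact: h2|].
  by apply: aeW => t _; rewrite /w; ring.
- rewrite uE ?in_itv/= ?lexx// subr0 mulr0 addr0 big1_seq ?addr0.
    by apply: ReImP; rewrite ?ReD ?ImD/= Rintegral_itv1 addr0.
  move=> j; rewrite mem_index_iota => /andP[_ /andP[_ jN]].
  by rewrite pospart_eq0 ?mulr0// sub0r oppr_le0; apply: x_ge0; exact: ltnW.
- have := volterra_form_right (xi 0%N isT) (L2_cinteg (wk 0%N isT)) (form 0%N isT).
  rewrite /S x0 big_geq// addr0.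
  suff -> : cint 0 0 w = 0 by rewrite addr0.
  by apply: ReImP; rewrite /= Rintegral_itv1.
Qed.

End Interaction.

(** * Increasing chains of nodes *)

Section Chains.
Context {C : comNzRingType}.
Variables (N : nat) (alpha U : nat -> C) (K : nat -> nat -> C).
Implicit Types (G : nat -> C) (J : seq nat).

(** For j > 0, the sum of [chain_weight] over the increasing chains of l.+1
    positive indices that end at j, defined by its recursion on the last
    step. *)
Fixpoint chain_coef l j : C :=
  if l is l'.+1 then alpha j * \sum_(1 <= i < j) chain_coef l' i * K i j
  else alpha j * U j.

Definition chain_weight J : C :=
  (\prod_(j <- J) alpha j) * U (head 0%N J) *
  \prod_(0 <= i < (size J).-1) K (nth 0%N J i) (nth 0%N J i.+1).

Lemma chain_weight_rcons J j : J != [::] ->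
  chain_weight (rcons J j) = chain_weight J * (alpha j * K (last 0%N J) j).
Proof.
case: J => [//|i J] _; rewrite /chain_weight big_rcons/= size_rcons /=.
rewrite big_nat_recr//= -rcons_cons !nth_rcons/= ltnn eqxx ltnSn -last_nth.
rewrite (@eq_big_nat _ _ _ _ _ _ (fun k => K (nth 0%N (i :: J) k) (nth 0%N J k))).
  by ring.
by move=> k /andP[_ kJ]; rewrite -rcons_cons !nth_rcons/= kJ ltnW.
Qed.

(** An increasing chain of positive indices that ends at j has at most j terms. *)
Lemma chain_coef_eq0 l j : (1 <= j <= l)%N -> chain_coef l j = 0.
Proof.
elim: l j => [|l IH] j /andP[j1 jl]; first by rewrite leqn0 in jl; rewrite (eqP jl) in j1.
rewrite /= big1_seq ?mulr0// => i; rewrite mem_index_iota => /andP[_ /andP[i1 ij]].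
by rewrite IH ?mul0r// i1 -ltnS (leq_trans ij).
Qed.

Definition chain_total j : C := \sum_(0 <= l < N) chain_coef l j.

(** Removing the last index of a chain relates chains of length l.+2 and l.+1.
    The chains of length N.+1 that appear have weight 0 by [chain_coef_eq0]. *)
Lemma chain_totalE j : (1 <= j <= N)%N ->
  chain_total j = alpha j * (U j + \sum_(1 <= i < j) chain_total i * K i j).
Proof.
move=> /andP[j1 jN]; rewrite /chain_total; case: N jN => [|n] jn.
  by rewrite leqn0 in jn; rewrite (eqP jn) in j1.
rewrite big_nat_recl//= mulrDr; congr (_ + _).
rewrite -mulr_sumr; congr (_ * _).
rewrite exchange_big_nat/=; apply: eq_big_nat => i /andP[i1 ij].
rewrite -mulr_suml big_nat_recr//= chain_coef_eq0 ?addr0//.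
by rewrite i1 -ltnS (leq_trans ij).
Qed.

Lemma big_tuple_rcons (T : finType) l (P : pred (l.+1.-tuple T)) (F : l.+1.-tuple T -> C) :
  \sum_(J : l.+1.-tuple T | P J) F J =
  \sum_(J : l.-tuple T) \sum_(j : T | P [tuple of rcons J j]) F [tuple of rcons J j].
Proof.
rewrite pair_big_dep/=.
rewrite (reindex (fun p : l.-tuple T * T => [tuple of rcons p.1 p.2])).
  by apply: eq_bigl => -[J j] /=.
apply/onW_bij/inj_card_bij; last by rewrite card_prod !card_tuple expnSr.
by move=> [J j] [J' j'] /(congr1 val)/rcons_inj[/val_inj -> ->].
Qed.

(** Induction on the length: after summation over the last index, G becomes a
    function G' of the index before it. *)
Lemma sum_chains l G :
  \sum_(J : l.+1.-tuple 'I_N.+1 | increasing_indices J)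
     chain_weight [seq val j | j <- J] * G (last 0%N [seq val j | j <- J]) =
  \sum_(1 <= j < N.+1) chain_coef l j * G j.
Proof.
elim: l G => [|l IH] G.
  rewrite big_tuple_rcons (big_pred1 [tuple]) => [|J]; last by apply/esym/eqP; exact: tuple0.
  rewrite [RHS]big_geq_mkord; apply: eq_big => [j|j _].
    by rewrite /increasing_indices/= !andbT.
  by rewrite /chain_weight/= big_seq1 big_geq// mulr1.
rewrite big_tuple_rcons.
pose G' i := \sum_(j : 'I_N.+1 | (i < j)%N) alpha j * K i j * G j.
transitivity (\sum_(J : l.+1.-tuple 'I_N.+1 | increasing_indices J)
     chain_weight [seq val j | j <- J] * G' (last 0%N [seq val j | j <- J])).
  rewrite [RHS]big_mkcond; apply: eq_bigr => J _.
  have J0 : [seq val j | j <- J] != [::] by case/tupleP: J.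
  have incr j : increasing_indices [tuple of rcons J j] =
      increasing_indices J && (last 0%N [seq val j | j <- J] < j)%N.
    rewrite /increasing_indices/= all_rcons map_rcons.
    case: (tval J) J0 => [//|i s] _; rewrite /= rcons_path/= !last_map.
    case: (leqP j (last i s)) => [|ij]; first by rewrite !andbF.
    by rewrite (leq_ltn_trans _ ij)// !andbT.
  case: ifP => Ji; last first.
    by rewrite big1// => j; rewrite incr Ji.
  rewrite mulr_sumr; apply: eq_big => [j|j _]; first by rewrite incr Ji.
  by rewrite /= map_rcons chain_weight_rcons// last_rcons; ring.
rewrite IH.
have tri i : G' i = \sum_(1 <= j < N.+1 | (i < j)%N) alpha j * K i j * G j.
  rewrite big_geq_mkord; apply: eq_bigl => j.
  by case: ltnP => // /(leq_ltn_trans (leq0n i)) ->.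
rewrite (eq_big_nat _ _ (F2 := fun i => \sum_(1 <= j < N.+1 | (i < j)%N)
    chain_coef l i * (alpha j * K i j * G j))); last first.
  by move=> i /andP[i1 _]; rewrite tri mulr_sumr.
rewrite (exchange_big_dep_nat xpredT)//=; apply: eq_big_nat => j /andP[_ jN].
rewrite [in RHS](big_nat_widen _ _ N.+1) ?(ltnW jN)//=.
by rewrite -mulrA mulr_suml mulr_sumr; apply: eq_bigr => i _; ring.
Qed.

End Chains.

(** * The regular problem and its delayed solutions *)

Section Regular.
Context {R : realType}.
Local Open Scope classical_set_scope.
Local Open Scope ring_scope.
Local Notation C := R[i].
Local Notation mu := (@lebesgue_measure R).
Local Notation integ D f := (mu.-integrable D (EFin \o f)).
Local Notation Re := complex.Re.
Local Notation Im := complex.Im.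
Implicit Types (a b c d t s e : R) (u v w p q : R -> C) (A S lambda : C).

(** Nodes of the interaction problem without interaction, which is the regular
    problem. *)
Definition end_nodes c (k : nat) : R := if k is 0%N then 0 else c.

Lemma regular_interaction c q (alpha : nat -> C) lambda (u0 u1 : C) u :
  regular_cauchy c q lambda u0 u1 u <->
  interaction_cauchy c q 0 (end_nodes c) alpha lambda u0 u1 u.
Proof.
split=> [[h1 h2 h3 h4 h5]|[[[h1 h2 _] h3] h4 h5]].
  split => //; split; last by case.
  split => //; first by case.
  by move=> [|k] //; rewrite ltn0 andbF.
by split => //; [exact: (h2 0%N)|exact: (h3 0%N)].
Qed.

Lemma regular_exists c q lambda (u0 u1 : C) : 0 < c -> L2 0 c q ->
  exists u, [/\ cbounded 0 c u,
    forall t, t \in `[0, c] -> u t = u0 + u1 * t%:C%C +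
      volterra 0 (fun s => (q s - lambda) * u s) t &
    unique_solution c (regular_cauchy c q lambda u0 u1) u].
Proof.
move=> c0 q2; have pi := L2_cinteg (L2_sub_cst lambda q2).
have fb : cbounded 0 c (fun t => u0 + u1 * t%:C%C).
  apply: ccont_bounded; split.
    rewrite (_ : re _ = fun t => Re u0 + Re u1 * t).
      apply: continuous_subspaceT => t; apply: cvgD; first exact: cvg_cst.
      by apply: cvgM; [exact: cvg_cst|exact: cvg_id].
    by apply/funext => t; rewrite /re ReD ReM/= mulr0 subr0.
  rewrite (_ : im _ = fun t => Im u0 + Im u1 * t).
    apply: continuous_subspaceT => t; apply: cvgD; first exact: cvg_cst.
    by apply: cvgM; [exact: cvg_cst|exact: cvg_id].
  by apply/funext => t; rewrite /im ImD ImM/= mulr0 add0r.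
have [u ub uE] := volterra_exists pi fb.
have xi k : (k <= 0)%N -> end_nodes c k < end_nodes c k.+1.
  by rewrite leqn0 => /eqP->.
have usol : interaction_cauchy c q 0 (end_nodes c) (fun=> 0) lambda u0 u1 u.
  apply: (@interaction_of_volterra _ _ _ _ _ _ (fun=> 0)) => //.
  - by move=> t tc; rewrite uE// big_geq// addr0 subr0.
  - by case.
exists u; split => //; split; first by apply/(regular_interaction _ _ (fun=> 0)).
move=> v /(regular_interaction _ _ (fun=> 0)) vsol.
exact: (interaction_unique q2 _ _ xi vsol usol).
Qed.

(** The factor H(t - d) s(t - d) of the formula: a solution started at d and
    extended by zero. *)
Definition delayed d (s : R -> C) t : C := heaviside (t - d) * s (t - d).

Lemma delayed_left d (s : R -> C) t : t <= d -> delayed d s t = 0.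
Proof. by move=> td; rewrite /delayed /heaviside subr_gt0 ltNge td mul0r. Qed.

Lemma delayed_right d (s : R -> C) t : d < t -> delayed d s t = s (t - d).
Proof. by move=> td; rewrite /delayed /heaviside subr_gt0 td mul1r. Qed.

Lemma delayed_bounded b d (s : R -> C) : 0 <= d -> cbounded 0 (b - d) s ->
  cbounded 0 b (delayed d s).
Proof.
move=> d0 [s1 s2 [M sM]].
have meas (f : R -> R) : measurable_fun `[0, b - d] f ->
    (forall t, t \in `[0, b - d] -> `|f t| <= M) ->
    measurable_fun `[0, b] (fun t => if d < t then f (t - d) else 0).
  move=> mf fM.
  have fi : integ `[0, b - d] f.
    apply: (@integ_le _ _ _ (fun=> M)) => //; exact: integ_cst.
  have := integ_meas (integ_shift_itv (- d) fi).
  rewrite sub0r !opprK subrK => mfd.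
  have mo : measurable_fun `]d, b] (fun t => f (t - d)).
    by apply: measurable_funS mfd => //; apply: subset_itvr; rewrite bnd_simp.
  have := (measurable_restrictT (fun t => f (t - d)) (measurable_itv `]d, b])).1 mo.
  move=> /(measurable_funS measurableT (@subsetT _ `[0, b]%classic)).
  apply: eq_measurable_fun => t; rewrite inE/= in_itv/= => /andP[_ tb].
  by rewrite patchE mem_setE in_itv/= tb andbT.
split.
- rewrite (_ : re _ = fun t => if d < t then re s (t - d) else 0).
    by apply: meas => // t tb; apply: le_trans (sM t tb); exact: Re_le_norm1.
  apply/funext => t; rewrite /re; case: ltP => td; first by rewrite delayed_right.
  by rewrite delayed_left.
- rewrite (_ : im _ = fun t => if d < t then im s (t - d) else 0).
    by apply: meas => // t tb; apply: le_trans (sM t tb); exact: Im_le_norm1.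
  apply/funext => t; rewrite /im; case: ltP => td; first by rewrite delayed_right.
  by rewrite delayed_left.
- exists `|M| => t; rewrite in_itv/= => /andP[t0 tb]; have [td|td] := leP t d.
    by rewrite delayed_left// /norm1/= !normr0 addr0.
  rewrite delayed_right// (le_trans (sM _ _)) ?ler_norm//.
  by rewrite in_itv/= subr_ge0 ltW//= lerD2r.
Qed.

Lemma volterra_shift d t w : cinteg d t w ->
  volterra d w t = volterra 0 (fun s => w (s + d)) (t - d).
Proof.
have E (f : R -> R) : integ `[d, t] f -> \int[mu]_(s in `[d, t]) ((t - s) * f s) =
    \int[mu]_(s in `[0, t - d]) ((t - d - s) * f (s + d)).
  move=> fi; have fi' : integ `[d, t] (fun s => (t - s) * f s) by exact: integ_kernel fi.
  rewrite -(Rintegral_shift d fi') subrr; apply: eq_Rintegral => s _.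
  by congr (_ * _); ring.
by move=> [w1 w2]; apply: ReImP; rewrite /= E.
Qed.

(** The delayed solution is 0 up to d, so its Volterra integral starts at d, and
    a translation brings it back to that of s. *)
Lemma delayed_volterra b d p (s : R -> C) : 0 <= d -> cinteg 0 b p ->
  cbounded 0 (b - d) s ->
  (forall t, t \in `[0, b - d] ->
     s t = 0 + 1 * t%:C%C + volterra 0 (fun r => p (r + d) * s r) t) ->
  forall t, t \in `[0, b] -> delayed d s t =
    (pospart (t - d))%:C%C + volterra 0 (fun r => p r * delayed d s r) t.
Proof.
move=> d0 pi sb sE t tb; have [t0 tb'] : 0 <= t /\ t <= b.
  by move: tb; rewrite in_itv/= => /andP[].
pose w r := p r * delayed d s r.
have [w1 w2] : cinteg 0 b w by apply: cinteg_mul => //; exact: delayed_bounded.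
have w0 r : r <= d -> w r = 0 by move=> rd; rewrite /w delayed_left// mulr0.
have int0 (f : R -> R) c : (forall r, r <= d -> f r = 0) -> c <= d ->
    \int[mu]_(r in `[0, c]) f r = 0.
  move=> f0 cd; rewrite -(@eq_Rintegral _ _ _ mu _ f (cst 0)) ?Rintegral_cst ?mul0r//.
  by move=> r; rewrite inE/= in_itv/= => /andP[_ rc]; rewrite f0// (le_trans rc).
have v0 c : c <= d -> volterra 0 w c = 0.
  move=> cd; apply: ReImP; rewrite /= int0// => r rd; rewrite /re /im w0// mulr0//.
have [td|td] := leP t d.
  by rewrite delayed_left// pospart_eq0 ?subr_le0// -/w v0// addr0.
rewrite delayed_right// pospart_id; last by rewrite subr_ge0 ltW.
rewrite (volterra_restart d0 (ltW td) (w := w)); last first.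
  by split; [exact: integ_subitv w1|exact: integ_subitv w2].
have -> : cint 0 d w = 0.
  by apply: ReImP; rewrite /= int0// => r rd; rewrite /re /im w0.
rewrite v0// mul0r !add0r volterra_shift; last first.
  by split; [exact: integ_subitv w1|exact: integ_subitv w2].
rewrite sE; last by rewrite in_itv/= subr_ge0 ltW//= lerD2r.
rewrite add0r mul1r; congr (_ + _); apply: eq_volterra => r.
rewrite in_itv/= => /andP[r0 _]; rewrite /w; congr (_ * _).
move: r0; rewrite le_eqVlt => /predU1P[<-|r0].
  rewrite add0r delayed_left// sE ?in_itv/= ?lexx ?subr_ge0 ?(le_trans (ltW td))//.
  by apply: ReImP; rewrite ?(ReD, ImD, ReM, ImM)/= !set_itv1 !Rintegral_set1; ring.
by rewrite delayed_right ?addrK// ltrDr.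
Qed.

End Regular.

(** * Superposition *)

Section Superposition.
Context {R : realType}.
Local Open Scope classical_set_scope.
Local Open Scope ring_scope.
Local Notation C := R[i].
Local Notation mu := (@lebesgue_measure R).
Local Notation integ D f := (mu.-integrable D (EFin \o f)).
Local Notation Re := complex.Re.
Local Notation Im := complex.Im.
Implicit Types (a b c d t s e : R) (f g u v w p q : R -> C) (A S lambda : C).

(** The Volterra equation with an arbitrary forcing term f, on which its
    solutions depend linearly. *)
Definition volterra_solution c p f u := cbounded 0 c u /\
  forall t, t \in `[0, c] -> u t = f t + volterra 0 (fun s => p s * u s) t.

Lemma volterraD a c v w t : t <= c -> cinteg a c v -> cinteg a c w ->
  volterra a (fun s => v s + w s) t = volterra a v t + volterra a w t.
Proof.
move=> tc [v1 v2] [w1 w2]; apply: ReImP; rewrite ?(ReD, ImD)/=.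
- rewrite -RintegralD//; [|exact: integ_kernel tc _..].
  by apply: eq_Rintegral => s _; rewrite /re ReD mulrDr.
- rewrite -RintegralD//; [|exact: integ_kernel tc _..].
  by apply: eq_Rintegral => s _; rewrite /im ImD mulrDr.
Qed.

Lemma volterraZ a c (k : C) w t : t <= c -> cinteg a c w ->
  volterra a (fun s => k * w s) t = k * volterra a w t.
Proof.
move=> tc [w1 w2].
have i1 := integ_kernel tc w1; have i2 := integ_kernel tc w2.
apply: ReImP; rewrite ?(ReM, ImM)/=.
- rewrite -!RintegralZl// -RintegralB//; [|exact: integZ..].
  by apply: eq_Rintegral => s _; rewrite /re ReM; ring.
- rewrite -!RintegralZl// -RintegralD//; [|exact: integZ..].
  by apply: eq_Rintegral => s _; rewrite /im ImM; ring.
Qed.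

Lemma volterra_solutionD c p f g u v : cinteg 0 c p ->
  volterra_solution c p f u -> volterra_solution c p g v ->
  volterra_solution c p (fun t => f t + g t) (fun t => u t + v t).
Proof.
move=> pi [ub uE] [vb vE]; split; first exact: cboundedD.
move=> t /[dup] tc; rewrite in_itv/= => /andP[_ tc'].
rewrite (@eq_volterra _ _ _ (fun s => p s * u s + p s * v s)); last first.
  by move=> s _; rewrite mulrDr.
by rewrite (volterraD tc') ?uE ?vE 1?addrACA//; exact: cinteg_mul.
Qed.

Lemma volterra_solutionZ c p (k : C) f u : cinteg 0 c p ->
  volterra_solution c p f u ->
  volterra_solution c p (fun t => k * f t) (fun t => k * u t).
Proof.
move=> pi [ub uE]; have [u1 u2 [M uM]] := ub; split.
  split.
  - rewrite (_ : re _ = fun t => Re k * re u t - Im k * im u t).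
      by apply: measurable_funB; exact: measurable_funM.
    by apply/funext => t; rewrite /re ReM.
  - rewrite (_ : im _ = fun t => Re k * im u t + Im k * re u t).
      by apply: measurable_funD; exact: measurable_funM.
    by apply/funext => t; rewrite /im ImM.
  - exists (norm1 k * M) => t tc; rewrite (le_trans (norm1M _ _))//.
    by rewrite ler_wpM2l ?norm1_ge0 ?uM.
move=> t /[dup] tc; rewrite in_itv/= => /andP[_ tc'].
rewrite (@eq_volterra _ _ _ (fun s => k * (p s * u s))); last first.
  by move=> s _; rewrite mulrCA.
by rewrite (volterraZ _ tc') ?uE ?mulrDr//; exact: cinteg_mul.
Qed.

Lemma volterra_solution0 c p : cinteg 0 c p ->
  volterra_solution c p (fun=> 0) (fun=> 0).
Proof.
move=> pi; have b0 : cbounded 0 c (fun=> 0 : C).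
  split; [exact: measurable_cst|exact: measurable_cst|].
  by exists 0 => t _; rewrite /norm1/= !normr0 addr0.
split => // t; rewrite in_itv/= => /andP[_ tc].
have E : volterra 0 (fun s => 0 * (p s * 0)) t = 0.
  by rewrite (volterraZ _ tc (cinteg_mul pi b0)) mul0r.
rewrite add0r -[LHS]E.
by apply: eq_volterra => s _; rewrite mulr0 mul0r.
Qed.

Lemma volterra_solution_sum c p (r : seq nat) (F G : nat -> R -> C) : cinteg 0 c p ->
  (forall k, k \in r -> volterra_solution c p (F k) (G k)) ->
  volterra_solution c p (fun t => \sum_(k <- r) F k t) (fun t => \sum_(k <- r) G k t).
Proof.
move=> pi; elim: r => [|k r IH] h.
  rewrite (_ : (fun t => _) = fun=> 0); last by apply/funext => t; rewrite big_nil.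
  rewrite (_ : (fun t => \sum_(k <- [::]) G k t) = fun=> 0); last first.
    by apply/funext => t; rewrite big_nil.
  exact: volterra_solution0.
rewrite (_ : (fun t => _) = fun t => F k t + \sum_(k <- r) F k t); last first.
  by apply/funext => t; rewrite big_cons.
rewrite (_ : (fun t => \sum_(k <- k :: r) G k t) = fun t => G k t + \sum_(k <- r) G k t); last first.
  by apply/funext => t; rewrite big_cons.
apply: volterra_solutionD => //; first by apply: h; rewrite mem_head.
by apply: IH => j jr; apply: h; rewrite in_cons jr orbT.
Qed.

(** The single sum of the formula consists of the chains of length 1 and the
    double sum of those of length 2 to N; all are grouped by their last
    index. *)
Lemma interaction_formulaE N (x : nat -> R) (alpha : nat -> C) (ut : R -> C)
    (s : nat -> R -> C) t :
  interaction_formula N x alpha ut s t = ut t + \sum_(1 <= k < N.+1)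
    chain_total N alpha (fun k => ut (x k)) (fun i j => s i (x j - x i)) k *
      delayed (x k) (s k) t.
Proof.
pose U k := ut (x k); pose K i j := s i (x j - x i).
pose G k := delayed (x k) (s k) t.
have chainE J : chain_term x alpha ut s J t = chain_weight alpha U K J * G (last 0%N J).
  by rewrite /chain_term /chain_weight /G /delayed /U /K; ring.
rewrite /interaction_formula -addrA; congr (_ + _).
have -> : \sum_(1 <= k < N.+1) alpha k * ut (x k) * heaviside (t - x k) * s k (t - x k) =
    \sum_(1 <= k < N.+1) chain_coef alpha U K 0 k * G k.
  by apply: eq_bigr => k _; rewrite /= /G /delayed -!mulrA.
have -> : \sum_(2 <= l < N.+1) \sum_(J : l.-tuple 'I_N.+1 | increasing_indices J)
      chain_term x alpha ut s [seq val j | j <- J] t =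
    \sum_(1 <= l < N) \sum_(1 <= k < N.+1) chain_coef alpha U K l k * G k.
  (* Chains of length l are counted by chain_coef l.-1. *)
  rewrite big_add1/=; apply: eq_bigr => l _; rewrite -sum_chains.
  by apply: eq_bigr => J _; rewrite chainE.
rewrite [RHS](eq_bigr (fun k => \sum_(0 <= l < N) chain_coef alpha U K l k * G k)); last first.
  by move=> k _; rewrite /chain_total mulr_suml.
case: N => [|n]; first by rewrite !big_geq// addr0.
by rewrite [RHS]exchange_big_nat/= [RHS]big_ltn.
Qed.

End Superposition.

Unset Implicit Arguments.

(** * The representation formula *)

Theorem theorem7 (R : realType) (b : R) (q : R -> R[i]) (N : nat)
    (x : nat -> R) (alpha : nat -> R[i]) (u0 u1 rho : R[i])
    (b_gt0 : 0 < b) (q_L2 : L2 0 b q)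
    (x_first : x 0%N = 0) (x_last : x N.+1 = b)
    (x_incr : forall k, (k <= N)%N -> x k < x k.+1)
    (alpha_neq0 : forall k, (1 <= k <= N)%N -> alpha k != 0) :
  exists (ut : R -> R[i]) (s : nat -> R -> R[i]),
    [/\ unique_solution b (regular_cauchy b q (rho ^+ 2) u0 u1) ut,
        forall k, (1 <= k <= N)%N ->
          unique_solution (b - x k)
            (regular_cauchy (b - x k) (fun t => q (t + x k)) (rho ^+ 2) 0 1)
            (s k) &
        unique_solution b
          (interaction_cauchy b q N x alpha (rho ^+ 2) u0 u1)
          (interaction_formula N x alpha ut s)].
Proof.
have xle := nodes_le x_incr.
have x_itv k : (1 <= k <= N)%N -> 0 <= x k < b.
  move=> /andP[_ kN]; rewrite -x_first xle//= ?leqW// -x_last.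
  by rewrite (lt_le_trans (x_incr k kN))// xle.
pose p t := q t - rho ^+ 2.
have pi : cinteg 0 b p := L2_cinteg (L2_sub_cst (rho ^+ 2) q_L2).
have [ut [ut_b utE ut_sol]] := regular_exists (rho ^+ 2) u0 u1 b_gt0 q_L2.
have fundamental k : exists sk, (1 <= k <= N)%N -> [/\ cbounded 0 (b - x k) sk,
    forall t, t \in `[0, b - x k] -> sk t = 0 + 1 * t%:C%C +
      volterra 0 (fun r => p (r + x k) * sk r) t &
    unique_solution (b - x k)
      (regular_cauchy (b - x k) (fun t => q (t + x k)) (rho ^+ 2) 0 1) sk].
  have [kN|_] := boolP (1 <= k <= N)%N; last by exists (fun=> 0).
  have /andP[k0 kb] := x_itv k kN.
  have q2 : L2 0 (b - x k) (fun t => q (t + x k)).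
    have [q1 q2] := L2_subinterval k0 (lexx b) q_L2.
    by have := L2_shift (x k) q1; have := L2_shift (x k) q2; rewrite subrr; split.
  have bk : 0 < b - x k by rewrite subr_gt0.
  by have [sk ?] := regular_exists (rho ^+ 2) 0 1 bk q2; exists sk.
have {fundamental} [s sP] := choice fundamental.
exists ut, s; split => //; first by move=> k /sP[].
pose U k := ut (x k); pose K i j := s i (x j - x i).
pose beta := chain_total N alpha U K.
set u := interaction_formula N x alpha ut s.
have uE t : u t = ut t + \sum_(1 <= k < N.+1) beta k * delayed (x k) (s k) t.
  exact: interaction_formulaE.
have [u_b u_volt] : volterra_solution b p (fun t => u0 + u1 * t%:C%C +
    \sum_(1 <= k < N.+1) beta k * (pospart (t - x k))%:C%C) u.
  rewrite (_ : u = fun t => ut t + \sum_(1 <= k < N.+1) beta k * delayed (x k) (s k) t); last first.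
    exact/funext.
  apply: volterra_solutionD => //.
  apply: volterra_solution_sum => // k; rewrite mem_index_iota => kN.
  have /andP[k0 kb] := x_itv k kN; have [s_b sE _] := sP k kN.
  apply: volterra_solutionZ => //; split; first exact: delayed_bounded.
  exact: delayed_volterra.
(* At x k only the solutions delayed by earlier nodes are nonzero, so that the
   recursion for beta becomes the jump condition. *)
have beta_alpha k : (1 <= k <= N)%N -> beta k = alpha k * u (x k).
  move=> kN; rewrite /beta chain_totalE// uE; congr (_ * (_ + _)).
  have /andP[k1 k2] := kN.
  rewrite [RHS](@big_cat_nat _ _ _ k)//= ?leqW//.
  rewrite [X in _ = _ + X]big1_seq ?addr0; last first.
    move=> j; rewrite mem_index_iota => /andP[_ /andP[kj jN]].
    by rewrite delayed_left ?mulr0// xle// leqW.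
  apply: eq_big_nat => j /andP[_ jk]; rewrite delayed_right//.
  by rewrite (lt_le_trans (x_incr j _))// ?xle ?leqW// (leq_trans (ltnW jk)).
have u_sol : interaction_cauchy b q N x alpha (rho ^+ 2) u0 u1 u.
  by apply: (@interaction_of_volterra _ _ _ _ _ _ beta) => // t /u_volt; rewrite subr0.
by split => // v v_sol; exact: (interaction_unique q_L2 x_first x_last x_incr v_sol u_sol).
Qed.
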